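(* Let $C:f=0$ be a reduced curve of degree $d\ge 3$ in $\mathbb{P}^2$ (over $\mathbb{C}$), and suppose that $C$ has type $2A$ and exponents $(d_1,d_2,d_3)$. Then the following hold. (1) If $d_1<d_2-2$, then $\nu(C)=2(d_3-d_2)+4\geq 4$. (2) If $d_1=d_2-2$, then $\nu(C)=2(d_3-d_1)\geq 4$. (3) If $d_1=d_2-1$, then $\nu(C)=2(d_3-d_1)+2\geq 4$. (4) If $d_1=d_2$, then $\nu(C)=2(d_3-d_2)+3\geq 3$.
   Context: Let $S=\mathbb{C}[x,y,z]$ with its standard grading. For a reduced curve $C:f=0$ of degree $d$ in $\mathbb{P}^2=\mathbb{P}^2_{\mathbb{C}}$, let $$D_0(f)=\{(a,b,c)\in S^3 : af_x+bf_y+cf_z=0\}$$ be the graded $S$-module of Jacobian syzygies, where a homogeneous element $(a,b,c)$ has degree $k$ if $a,b,c$ are homogeneous of degree $k$. Let $d_1\leq d_2\leq\dots\leq d_m$ be the degrees of the elements of a minimal system of homogeneous generators of $D_0(f)$; $(d_1,\dots,d_m)$ are the exponents of $C$. The type of $C$ is $t(C)=d_1+d_2+1-d$. A curve of type $2$ has $m=3$ or $m=4$; it is said to be of type $2A$ if $m=3$ and of type $2B$ if $m=4$. Let $J_f=(f_x,f_y,f_z)$ be the Jacobian ideal, $I_f$ its saturation with respect to $\mathbf{m}=(x,y,z)$, and $N(f)=I_f/J_f$ the graded Jacobian module. The freeness defect of $C$ is $\nu(C)=\max_j\{\dim_{\mathbb{C}} N(f)_j\}$. *)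

(* Defs.v *)
From mathcomp Require Import all_boot all_order all_algebra.
From mathcomp Require Import mpoly.
From mathcomp Require Import boolp classical_sets reals complex.

Set Implicit Arguments.
Unset Strict Implicit.
Unset Printing Implicit Defensive.

Import Order.TTheory GRing.Theory Num.Theory.
Local Open Scope ring_scope.
Local Open Scope complex_scope.

(* For R : realType, R[i] is the field of complex numbers. *)
Notation S3 R := {mpoly R[i][3]}.

(* Squarefree: the only square factors of f are squares of units. *)
Definition reduced (R : realType) (f : S3 R) : Prop :=
  forall g h : S3 R, f = g ^+ 2 * h -> g \is a GRing.unit.

Definition reduced_curve (R : realType) (d : nat) (f : S3 R) : Prop :=
  [/\ f != 0, f \is d.-homog & reduced f].

Definition D0 (R : realType) (f : S3 R) (s : 'rV[S3 R]_3) : Prop :=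
  \sum_(i < 3) s 0 i * f^`M(i) = 0.

Definition homog_triple (R : realType) (k : nat) (s : 'rV[S3 R]_3) : Prop :=
  forall i : 'I_3, s 0 i \is k.-homog.

Definition generates_D0 (R : realType) (f : S3 R) (m : nat)
    (r : 'I_m -> 'rV[S3 R]_3) (A : {set 'I_m}) : Prop :=
  forall s : 'rV[S3 R]_3,
    D0 f s <-> exists c : 'I_m -> S3 R, s = \sum_(j in A) c j *: r j.

Definition minimal_generators_D0 (R : realType) (f : S3 R) (m : nat)
    (r : 'I_m -> 'rV[S3 R]_3) : Prop :=
  generates_D0 f r [set: 'I_m] /\
  forall A : {set 'I_m}, A \proper [set: 'I_m] -> ~ generates_D0 f r A.

(* ds = [:: d_1; ...; d_m]; the indices are shifted by one in nth 0 ds j. *)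
Definition exponents (R : realType) (f : S3 R) (ds : seq nat) : Prop :=
  sorted leq ds /\
  exists r : 'I_(size ds) -> 'rV[S3 R]_3,
    (forall j : 'I_(size ds), homog_triple (nth 0%N ds j) (r j)) /\
    minimal_generators_D0 f r.

Definition curve_type (d : nat) (ds : seq nat) : int :=
  (nth 0%N ds 0)%:Z + (nth 0%N ds 1)%:Z + 1 - d%:Z.

Definition type2A (d : nat) (ds : seq nat) : Prop :=
  curve_type d ds = 2 /\ size ds = 3%N.

Definition jacobian_ideal (R : realType) (f g : S3 R) : Prop :=
  exists c : 'I_3 -> S3 R, g = \sum_(i < 3) c i * f^`M(i).

(* g lies in the saturation iff (x,y,z)^k g is contained in J_f for some k;
   the ideal (x,y,z)^k is generated by the monomials of degree k. *)
Definition saturated_ideal (R : realType) (f g : S3 R) : Prop :=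
  exists k : nat, forall m : 'X_{1..3},
    mdeg m = k -> jacobian_ideal f ('X_[m] * g).

(* dim N(f)_j = n: there are b_1, ..., b_n in (I_f)_j whose classes form a
   basis of (I_f)_j / (J_f)_j, i.e. every element of (I_f)_j is congruent
   modulo J_f to a unique C-linear combination of the b_i. *)
Definition jacobian_module_dim (R : realType) (f : S3 R) (j n : nat) : Prop :=
  exists b : 'I_n -> S3 R,
    (forall i, b i \is j.-homog /\ saturated_ideal f (b i)) /\
    forall g : S3 R, g \is j.-homog -> saturated_ideal f g ->
      exists! c : 'rV[R[i]]_n,
        jacobian_ideal f (g - \sum_(i < n) c 0 i *: b i).

Definition is_freeness_defect (R : realType) (f : S3 R) (n : nat) : Prop :=
  (exists j, jacobian_module_dim f j n) /\
  forall j, exists2 k, jacobian_module_dim f j k & (k <= n)%N.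

(* The unique n with is_freeness_defect f n (0 if there is none). *)
Definition freeness_defect (R : realType) (f : S3 R) : nat :=
  xget 0%N [set n | is_freeness_defect f n]%classic.

(* Main.v *)
From HB Require Import structures.
Require Import Defs.
From mathcomp Require Import all_boot all_order all_algebra.
From mathcomp Require Import mpoly.
From mathcomp Require Import boolp classical_sets reals complex.
From mathcomp Require Import ring zify.

Import Order.TTheory GRing.Theory Num.Theory.
Local Open Scope ring_scope.
Local Open Scope complex_scope.

Set Implicit Arguments.
Unset Strict Implicit.
Unset Printing Implicit Defensive.

(** Write F = (f_x, f_y, f_z), S = C[x,y,z], and let r_1, r_2, r_3 generate the
    syzygy module D_0(f). The proof identifies the Jacobian module with a
    shift of S / (g_1, g_2, g_3) for a complete intersection whose degrees are
    known, and reads its largest dimension off the Hilbert function.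

    The relation g. As f is reduced, no prime divides all entries of F: by
    Euler's identity it would divide f, and then its square would. Unique factorization in S
    turns this into exactness of v |-> F x v (gradient_cross): F x v = 0
    only if v is a multiple of F. Cross products of syzygies are parallel to
    F, so r_2 x r_3 = g_1 F, r_3 x r_1 = g_2 F and r_1 x r_2 = g_3 F for some
    polynomials g_i, and Cramer's rule gives g_1 r_1 + g_2 r_2 + g_3 r_3 = 0.
    This determines the degrees: as d_1 + d_2 = d + 1, the form g_3 is
    a conic, and g_2, g_1 have degrees p = d_3 - d_2 + 2 and
    q = d_3 - d_1 + 2.

    The complex 0 -> S -> S^3 -> S^3 -> S with maps g, r and F is exact. It
    has length three, which forces the ideal (g) to have depth three: the
    Koszul complex of g is exact (g_dot). So g is a regular sequence,
    and S / (g) has Hilbert series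
    (1 + t)(1 + ... + t^(p-1))(1 + ... + t^(q-1)). Its largest coefficient is
    2p if p < q and 2p - 1 if p = q (hilbert_function_bounds); in
    particular (g) contains all forms of large degree.

    The Jacobian module. Exactness of the Koszul complex extends the identity
    of S and S^3 to a map of complexes, whose last component is multiplication
    by a form u of degree 2 d - d_3 - 4 (comparison_map). Its mapping cone
    shows that s u lies in J_f exactly if s lies in (g) (colon_u), and that
    S / (J_f + (u)) has a resolution of length two, so that J_f + (u) is
    saturated (cone_saturated). Since (g) contains a power of the irrelevant
    ideal, J_f + (u) is the saturation I_f, and multiplication by u is an
    isomorphism from S / (g) onto N(f) (jacobian_module_hilbert). Hence
    nu = 2p if d_1 < d_2 and nu = 2p - 1 if d_1 = d_2; the four cases are
    rewritings of this. *)

(** * Unique factorization in polynomial rings *)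

Definition divides (A : comPzRingType) (a b : A) : Prop := exists c, b = a * c.

Definition is_prime (A : idomainType) (p : A) : Prop :=
  [/\ p != 0, p \isn't a GRing.unit &
      forall a b, divides p (a * b) -> divides p a \/ divides p b].

(** For a domain this is equivalent to unique factorization: factorizations
    into primes are automatically unique. *)
Definition factorial_domain (A : idomainType) : Prop :=
  forall a : A, a != 0 -> exists (u : A) (s : seq A),
    [/\ u \is a GRing.unit, forall p, p \in s -> is_prime p
      & a = u * \prod_(p <- s) p].

Lemma divides_mull (A : comPzRingType) (a b c : A) :
  divides a b -> divides a (c * b).
Proof. by case=> e ->; exists (c * e); rewrite mulrCA. Qed.

Lemma divides_trans (A : comPzRingType) (a b c : A) :
  divides a b -> divides b c -> divides a c.
Proof. by case=> e -> [e' ->]; exists (e * e'); rewrite mulrA. Qed.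

Lemma divides_add (A : comPzRingType) (a b c : A) :
  divides a b -> divides a c -> divides a (b + c).
Proof. by case=> e -> [e' ->]; exists (e + e'); rewrite mulrDr. Qed.

Lemma prime_ndvd_unit (A : idomainType) (p u : A) :
  is_prime p -> u \is a GRing.unit -> ~ divides p u.
Proof. by case=> _ /negP nu _ uu [c e]; apply: nu; move: uu; rewrite e unitrM; case/andP. Qed.

Lemma prime_divides_prod (A : idomainType) (p : A) (s : seq A) :
  is_prime p -> divides p (\prod_(q <- s) q) -> exists2 q, q \in s & divides p q.
Proof.
move=> pp; elim: s => [|q s IHs].
  by rewrite big_nil => /(prime_ndvd_unit pp (unitr1 _)).
rewrite big_cons; case: (pp) => _ _ /[apply] -[dq|/IHs[q' q's dq']].
  by exists q => //; rewrite mem_head.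
by exists q' => //; rewrite inE q's orbT.
Qed.

Lemma divides_prime_sym (A : idomainType) (p q : A) :
  is_prime p -> is_prime q -> divides p q -> divides q p.
Proof.
move=> pp pq [c e]; case: (pq) => nzq _ /(_ p c).
case; [by exists 1; rewrite mulr1|by []|case=> c' ec].
case: pp => _ /negP[]; apply/unitrPr; exists c'.
by apply: (mulfI nzq); rewrite mulr1 {2}e ec; ring.
Qed.

(** [A[X]] stays a domain modulo a prime [p] of [A]: the induction strips leading terms divisible by [p], and once neither leading
    coefficient is divisible by [p] neither is their product. *)
Lemma polyC_prime (A : idomainType) (p : A) : is_prime p -> is_prime p%:P.
Proof.
move=> [nzp nup pp].
have coefdvd (a : {poly A}) : divides p%:P a -> forall i, divides p a`_i.
  by case=> c -> i; exists c`_i; rewrite coefCM.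
split; [by rewrite polyC_eq0| |].
  apply: contra nup; rewrite poly_unitE coefC eqxx => /andP[_]; exact.
move=> a b; have [n] := ubnP (size a + size b).
elim: n a b => // n IHn a b; rewrite ltnS => le_ab dab.
have [->|nza] := eqVneq a 0; first by left; exists 0; rewrite mulr0.
have [->|nzb] := eqVneq b 0; first by right; exists 0; rewrite mulr0.
have strip (q : {poly A}) : q != 0 -> divides p (lead_coef q) ->
    exists q' : {poly A}, (size q' < size q)%N /\ exists c : {poly A}, q = q' + p%:P * c.
  move=> nzq [c ec]; exists (q - lead_coef q *: 'X^((size q).-1)); split.
    rewrite -[X in (_ < X)%N](prednK (_ : 0 < size q)%N) ?size_poly_gt0 //.
    rewrite ltnS; apply/leq_sizeP => j lj; rewrite coefB coefZ coefXn.
    have [->|nj] := eqVneq j (size q).-1; first by rewrite mulr1 subrr.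
    rewrite mulr0 subr0 nth_default //.
    by rewrite -(prednK (_ : 0 < size q)%N) ?size_poly_gt0 // ltn_neqAle eq_sym nj.
  exists (c *: 'X^((size q).-1)).
  by rewrite mul_polyC scalerA -ec subrK.
have : divides p (lead_coef a * lead_coef b).
  by rewrite -lead_coefM; apply: coefdvd.
case/pp => dl.
  case: (strip a nza dl) => a' [sa' [c ea]].
  have dab' : divides p%:P (a' * b).
    have -> : a' * b = a * b + p%:P * (- c * b) by rewrite ea; ring.
    by apply: divides_add => //; exists (- c * b).
  case: (IHn a' b _ dab'); [by rewrite (leq_trans _ le_ab) // ltn_add2r| |by right].
  by left; rewrite ea; apply: divides_add => //; exists c.
case: (strip b nzb dl) => b' [sb' [c eb]].
have dab' : divides p%:P (a * b').
  have -> : a * b' = a * b + p%:P * (- c * a) by rewrite eb; ring.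
  by apply: divides_add => //; exists (- c * a).
case: (IHn a b' _ dab'); [by rewrite (leq_trans _ le_ab) // ltn_add2l|by left|].
by right; rewrite eb; apply: divides_add => //; exists c.
Qed.

(** Having content one: no prime constant divides the polynomial. *)
Definition primitive (A : idomainType) (a : {poly A}) : Prop :=
  forall p : A, is_prime p -> ~ divides p%:P a.

Section GaussLemma.
Variable A : idomainType.
Hypothesis factA : factorial_domain A.

(** Divisibility over the fraction field by a primitive polynomial is honest
    divisibility: the primes of the denominator can be cancelled. *)
Lemma primitive_dvdp (q a : {poly A}) :
  primitive q -> Pdiv.Idomain.dvdp q a -> divides q a.
Proof.
move=> primq /Pdiv.Idomain.dvdpP[[c w] /= nzc].
case: (factA nzc) => u [s [uu ps ->]].
rewrite -scalerA [in w * q]mulrC => e; have {e} : exists w,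
    (\prod_(p <- s) p) *: a = q * w.
  by exists (u^-1 *: w); rewrite -scalerAr -e [RHS]scalerA mulVr // scale1r.
elim: s ps => [_ [w']|p s IHs ps].
  by rewrite big_nil scale1r => ->; exists w'.
rewrite big_cons -scalerA => -[w' e].
have pp : is_prime p by apply: ps; rewrite mem_head.
have : divides p%:P (q * w').
  by rewrite -e -mul_polyC; exists ((\prod_(p <- s) p) *: a).
case: (polyC_prime pp) => nzp _ /[apply] -[/(primq _ pp) //|[w2 ew]].
apply: IHs => [r rs|]; first by apply: ps; rewrite inE rs orbT.
exists w2; apply: (mulfI nzp); rewrite mul_polyC e ew; ring.
Qed.

(** Strips prime constants one at a time; the primes of the leading coefficient
    are the only candidates, which bounds the process. *)
Lemma primitive_part (a : {poly A}) : a != 0 ->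
  exists (s : seq A) (b : {poly A}),
   [/\ forall p, p \in s -> is_prime p, a = (\prod_(p <- s) p)%:P * b & primitive b].
Proof.
move=> nza; have nzl : lead_coef a != 0 by rewrite lead_coef_eq0.
case: (factA nzl) => u [s [uu ps ea]].
(* [t] collects the prime factors of the leading coefficient that are already
   known not to divide the polynomial. *)
have: exists t : seq A, [/\ forall p, p \in t -> is_prime p,
    forall p, p \in t -> ~ divides p%:P a
    & lead_coef a = u * \prod_(p <- s) p * \prod_(p <- t) p].
  by exists [::]; rewrite big_nil mulr1.
elim: s {ea nzl} a nza ps => [|p s IHs] a nza ps [t [pt nt ea]].
  exists [::], a; split=> //; first by rewrite big_nil polyC1 mul1r.
  move=> p pp dpa; move: (dpa) => [c ec].
  have : divides p (lead_coef a).
    by rewrite ec lead_coefM lead_coefC; exists (lead_coef c).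
  rewrite ea big_nil mulr1; case: (pp) => _ _ /[apply] -[/(prime_ndvd_unit pp uu) //|].
  move=> /(prime_divides_prod pp)[q qt dq]; apply: (nt q qt).
  apply: divides_trans dpa.
  have [e ->] := divides_prime_sym pp (pt q qt) dq.
  by exists e%:P; rewrite polyCM.
have pp : is_prime p by apply: ps; rewrite mem_head.
have ps' q : q \in s -> is_prime q by move=> qs; apply: ps; rewrite inE qs orbT.
case: (pselect (divides p%:P a)) => [[c ec]|ndp].
  have nzc : c != 0 by apply: contraNneq nza => c0; rewrite ec c0 mulr0.
  have nzp : p != 0 by case: pp.
  case: (IHs c nzc ps').
    exists t; split=> // [q qt [e ee]|].
      by apply: (nt q qt); rewrite ec ee; exists (p%:P * e); ring.
    apply: (mulfI nzp); have := ea; rewrite ec lead_coefM lead_coefC => ->.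
    by rewrite big_cons; ring.
  move=> s' [b [ps'' eb prb]]; exists (p :: s'), b; split=> //.
    by move=> q; rewrite inE => /orP[/eqP->|/ps''].
  by rewrite big_cons polyCM -mulrA -eb.
apply: IHs => //; exists (p :: t); split=> [q|q|].
- by rewrite inE => /orP[/eqP->|/pt].
- by rewrite inE => /orP[/eqP->|/nt].
- by rewrite ea !big_cons; ring.
Qed.

(** Gauss's lemma: a primitive polynomial without proper factors over the
    fraction field is prime. *)
Lemma primitive_irreducible_prime (a : {poly A}) : primitive a ->
  (1 < size a)%N ->
  (forall q : {poly A}, Pdiv.Idomain.dvdp q a -> (1 < size q)%N -> size q = size a) ->
  is_prime a.
Proof.
move=> pra sa irr.
have nza : a != 0 by rewrite -size_poly_gt0 ltnW.
split=> //.
  by rewrite poly_unitE negb_and; apply/orP; left; rewrite gtn_eqF.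
move=> b c [e ebc].
have dbc : Pdiv.Idomain.dvdp a (b * c) by rewrite ebc Pdiv.Idomain.dvdp_mulr.
case: (boolP (Pdiv.Idomain.coprimep a b)) => [cop|].
  by right; apply: primitive_dvdp => //; rewrite -(Pdiv.Idomain.Gauss_dvdpr _ cop).
rewrite Pdiv.Idomain.coprimep_def => ng; left; apply: primitive_dvdp => //.
have nzg : Pdiv.Idomain.gcdp a b != 0.
  by rewrite Pdiv.Idomain.gcdp_eq0 (negPf nza).
have sg : (1 < size (Pdiv.Idomain.gcdp a b))%N.
  by rewrite ltn_neqAle eq_sym ng size_poly_gt0.
have := irr _ (Pdiv.Idomain.dvdp_gcdl a b) sg => /eqP.
rewrite Pdiv.Idomain.dvdp_size_eqp ?Pdiv.Idomain.dvdp_gcdl // => /andP[_ h].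
exact: Pdiv.Idomain.dvdp_trans h (Pdiv.Idomain.dvdp_gcdr a b).
Qed.

(** Induction on the degree: a factor over the fraction field can be replaced by
    its primitive part, which is then an honest factor. *)
Lemma primitive_factor (a : {poly A}) : a != 0 -> primitive a ->
  exists (u : {poly A}) (s : seq {poly A}),
    [/\ u \is a GRing.unit, forall p, p \in s -> is_prime p
      & a = u * \prod_(p <- s) p].
Proof.
have [n] := ubnP (size a); elim: n a => // n IHn a; rewrite ltnS => le_an nza pra.
have [sa|sa] := leqP (size a) 1.
  move/size1_polyC: sa => ea; have nz0 : a`_0 != 0.
    by apply: contraNneq nza => a0; rewrite ea a0 polyC0.
  case: (factA nz0) => u [[|p s] [uu ps e]].
    exists a, [::]; rewrite big_nil mulr1; split=> //.
    by rewrite ea e big_nil mulr1 rmorph_unit.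
  exfalso; apply: (pra p); first by apply: ps; rewrite mem_head.
  rewrite ea e big_cons !polyCM; exists (u%:P * (\prod_(q <- s) q)%:P); ring.
case: (pselect (exists q : {poly A},
   [/\ Pdiv.Idomain.dvdp q a, (1 < size q)%N & size q != size a])) => [|nq].
  case=> q [dqa sq nsq].
  have nzq : q != 0 by rewrite -size_poly_gt0 ltnW.
  have [s0 [b [ps0 eq prb]]] := primitive_part nzq.
  (* replace the factor by its primitive part *)
  have [c ea] : divides b a.
    apply: primitive_dvdp => //; apply: Pdiv.Idomain.dvdp_trans dqa.
    by rewrite eq Pdiv.Idomain.dvdp_mull.
  have nzc : c != 0 by apply: contraNneq nza => c0; rewrite ea c0 mulr0.
  have nzb : b != 0 by apply: contraNneq nza => b0; rewrite ea b0 mul0r.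
  have sb : size b = size q.
    rewrite eq mul_polyC size_scale //; apply: contraNneq nzq => e0.
    by rewrite eq e0 polyC0 mul0r.
  have sa' : size a = (size b + size c).-1 by rewrite ea size_mul.
  have sc : (0 < size c)%N by rewrite size_poly_gt0.
  have [lb lc] : (size b < n)%N /\ (size c < n)%N.
    by move: sa' sc le_an nsq sq; rewrite -sb; lia.
  have prc : primitive c.
    by move=> p pp /(divides_mull b); rewrite -ea; apply: pra.
  have [u [s [uu ps eb]]] := IHn b lb nzb prb.
  have [v [t [uv pt ec]]] := IHn c lc nzc prc.
  exists (u * v), (s ++ t); split.
  - by rewrite unitrM uu uv.
  - by move=> p; rewrite mem_cat => /orP[/ps|/pt].
  - by rewrite ea {1}eb {1}ec big_cat /=; ring.
exists 1, [:: a]; rewrite big_seq1 mul1r unitr1; split=> // p; rewrite inE => /eqP->.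
apply: primitive_irreducible_prime => // q dq sq; apply/eqP/negPn/negP => nsq.
by apply: nq; exists q.
Qed.

Lemma factorial_poly : factorial_domain {poly A}.
Proof.
move=> a nza; have [s [b [ps ea prb]]] := primitive_part nza.
have nzb : b != 0 by apply: contraNneq nza => b0; rewrite ea b0 mulr0.
have [u [t [uu pt eb]]] := primitive_factor nzb prb.
exists u, ([seq p%:P | p <- s] ++ t); split=> // [p|].
  by rewrite mem_cat => /orP[/mapP[q /ps pq ->]|/pt //]; exact: polyC_prime.
by rewrite ea {1}eb big_cat big_map rmorph_prod /=; ring.
Qed.

End GaussLemma.

Lemma factorial_transfer (A B : idomainType) (f : {rmorphism A -> B})
  (g : {rmorphism B -> A}) : cancel f g -> cancel g f ->
  factorial_domain B -> factorial_domain A.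
Proof.
move=> fK gK factB a nza.
have nzfa : f a != 0 by apply: contraNneq nza => e; rewrite -(fK a) e rmorph0.
have [u [s [uu ps e]]] := factB _ nzfa.
exists (g u), [seq g p | p <- s]; split.
- exact: rmorph_unit.
- move=> _ /mapP[p /ps [nzp nup pp] ->]; split.
  + by apply: contraNneq nzp => e0; rewrite -(gK p) e0 rmorph0.
  + by apply: contra nup => /(rmorph_unit f); rewrite gK.
  move=> b c [d ed]; have : divides p (f b * f c).
    by exists (f d); rewrite -rmorphM ed rmorphM gK.
  by case/pp => -[d' ed']; [left|right]; exists (g d'); rewrite -rmorphM -ed' fK.
- by rewrite big_map -rmorph_prod -rmorphM -e fK.
Qed.

Section MPolyAsPoly.
Variables (n : nat) (K : fieldType).

(** The inverse of [muni]: evaluate at the last variable. *)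
Definition last_var_eval (p : {poly {mpoly K[n]}}) : {mpoly K[n.+1]} :=
  (map_poly (@mwiden n K) p).['X_ord_max].

HB.instance Definition _ := GRing.RMorphism.copy last_var_eval
  (horner_eval ('X_ord_max : {mpoly K[n.+1]}) \o map_poly (@mwiden n K)).

Lemma muniX_max : muni ('X_ord_max : {mpoly K[n.+1]}) = 'X.
Proof.
rewrite muniE msuppX big_seq1 mcoeffX eqxx scale1r mnmE eqxx expr1.
rewrite (_ : [multinom _ | _ < _] = 0%MM) ?mpolyX0 ?scale1r //.
by apply/mnmP => i; rewrite !mnmE -val_eqE /= gtn_eqF.
Qed.

Lemma muniX_widen (i : 'I_n) :
  muni ('X_(widen_ord (leqnSn n) i) : {mpoly K[n.+1]}) = ('X_i)%:P.
Proof.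
rewrite muniE msuppX big_seq1 mcoeffX eqxx scale1r mnmE.
rewrite -val_eqE /= ltn_eqF // expr0 alg_polyC; congr (_%:P).
by congr ('X_[_]); apply/mnmP => j; rewrite !mnmE -val_eqE.
Qed.

(** The mutual inverses below are compared on constants and variables only. *)
Lemma mpoly_rmorph_ext (B : nzRingType) (m : nat) (f g : {rmorphism {mpoly K[m]} -> B}) :
  (forall c, f c%:MP = g c%:MP) -> (forall i, f 'X_i = g 'X_i) -> f =1 g.
Proof.
move=> fgC fgX; elim/mpolyind => [|c u p _ _ IHp]; first by rewrite !rmorph0.
rewrite !rmorphD IHp -mul_mpolyC !rmorphM fgC mpolyXE_id !rmorph_prod.
by congr (_ * _ + _); apply: eq_bigr => i _; rewrite !rmorphXn fgX.
Qed.

Lemma muniK : cancel (@muni n K) last_var_eval.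
Proof.
apply: (@mpoly_rmorph_ext _ _ (last_var_eval \o @muni n K) idfun) => [c|i] /=.
  by rewrite muniC /last_var_eval map_polyC hornerC; exact: mwidenC.
have [j ->|->] := unliftP ord_max i.
  rewrite (_ : lift _ _ = widen_ord (leqnSn n) j); last first.
    by apply: val_inj; rewrite /= /bump leqNgt ltn_ord.
  rewrite muniX_widen /last_var_eval map_polyC hornerC [LHS]mwidenX; congr ('X_[_]).
  by rewrite mnmwiden1; congr U_(_)%MM; apply: val_inj.
by rewrite muniX_max /last_var_eval map_polyX hornerX.
Qed.

Lemma muni_mwiden (p : {mpoly K[n]}) : muni (mwiden p) = p%:P.
Proof.
apply: (@mpoly_rmorph_ext _ _ (@muni n K \o @mwiden n K) polyC) => [c|i] /=.
  by rewrite mwidenC muniC.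
rewrite mwidenX mnmwiden1 -muniX_widen.
by congr (muni 'X_[U_(_)%MM]); apply: val_inj.
Qed.

Lemma last_var_evalK : cancel last_var_eval (@muni n K).
Proof.
elim/poly_ind => [|p c IHp]; first by rewrite !rmorph0.
have -> : last_var_eval (p * 'X + c%:P) = last_var_eval p * 'X_ord_max + mwiden c.
  by rewrite /last_var_eval rmorphD rmorphM /= map_polyX map_polyC hornerMXaddC.
by rewrite muniD muniM IHp muniX_max muni_mwiden.
Qed.

End MPolyAsPoly.

Lemma factorial_mpoly (K : fieldType) (n : nat) : factorial_domain {mpoly K[n]}.
Proof.
elim: n => [p nzp|n IHn].
  exists p, [::]; rewrite big_nil mulr1; split=> //.
  have ep : p = (p@_0)%:MP.
    by apply/mpolyP => m; rewrite mcoeffC (_ : m = 0%MM) ?eqxx ?mulr1 //; apply/mnmP; case.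
  rewrite ep rmorph_unit // unitfE; apply: contraNneq nzp => e.
  by rewrite ep e mpolyC0.
exact: factorial_transfer (@muniK n K) (@last_var_evalK n K) (factorial_poly IHn).
Qed.

(** * Vector calculus over a domain *)

Definition i0 : 'I_3 := @Ordinal 3 0 isT.
Definition i1 : 'I_3 := @Ordinal 3 1 isT.
Definition i2 : 'I_3 := @Ordinal 3 2 isT.

Lemma ord3_ind (P : 'I_3 -> Prop) : P i0 -> P i1 -> P i2 -> forall i, P i.
Proof.
move=> P0 P1 P2 [[|[|[|//]]] h].
- by rewrite (_ : Ordinal h = i0) //; apply: val_inj.
- by rewrite (_ : Ordinal h = i1) //; apply: val_inj.
- by rewrite (_ : Ordinal h = i2) //; apply: val_inj.
Qed.

Lemma sum_ord3 (V : nmodType) (G : 'I_3 -> V) : \sum_(i < 3) G i = G i0 + G i1 + G i2.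
Proof.
rewrite !big_ord_recl big_ord0 addr0 addrA.
by congr (G _ + G _ + G _); apply: val_inj.
Qed.

Section VectorCalculus.
Variable A : idomainType.
Implicit Types a b c v : 'I_3 -> A.

Definition dot a b : A := a i0 * b i0 + a i1 * b i1 + a i2 * b i2.

Definition cross a b (i : 'I_3) : A :=
  nth 0 [:: a i1 * b i2 - a i2 * b i1; a i2 * b i0 - a i0 * b i2;
            a i0 * b i1 - a i1 * b i0] i.

Definition lincomb (t : 'I_3 -> A) (r : 'I_3 -> 'I_3 -> A) (l : 'I_3) : A :=
  dot t (r^~ l).

Lemma eq_cross a a' b b' : a =1 a' -> b =1 b' -> cross a b =1 cross a' b'.
Proof. by move=> ea eb; apply: ord3_ind; rewrite /cross /= !ea !eb. Qed.

(** Exactness of the Koszul complex of [v] at its two middle terms: the first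
    says that the ideal of [v] has depth at least two, the second (given the
    first) that it has depth three. *)
Definition cross_exact v : Prop :=
  forall a, (forall i, cross v a i = 0) -> exists p, forall i, a i = p * v i.

Definition dot_exact v : Prop :=
  forall a, dot a v = 0 -> exists c, forall i, a i = cross v c i.

(** Certificates: an equation follows from others once the difference of its
    sides is exhibited as a combination of theirs, which [ring] can verify. *)
Lemma eq_lincomb1 (x y l m c : A) : x = y -> l - m = c * (x - y) -> l = m.
Proof. by move=> ->; rewrite subrr mulr0 => /subr0_eq. Qed.

Lemma eq_lincomb2 (x y x' y' l m c c' : A) : x = y -> x' = y' ->
  l - m = c * (x - y) + c' * (x' - y') -> l = m.
Proof. by move=> -> ->; rewrite !subrr !mulr0 addr0 => /subr0_eq. Qed.

Lemma eq_lincomb3 (x y x' y' x2 y2 l m c c' c2 : A) : x = y -> x' = y' -> x2 = y2 ->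
  l - m = c * (x - y) + c' * (x' - y') + c2 * (x2 - y2) -> l = m.
Proof. by move=> -> -> ->; rewrite !subrr !mulr0 !addr0 => /subr0_eq. Qed.

Lemma cross_cross a b c i : cross c (cross a b) i = a i * dot b c - b i * dot a c.
Proof. by move: i; apply: ord3_ind; rewrite /cross /dot /=; ring. Qed.

Lemma eq_dotr a b b' : b =1 b' -> dot a b = dot a b'.
Proof. by move=> eb; rewrite /dot !eb. Qed.

Lemma dot0 a : dot a (fun=> 0) = 0.
Proof. by rewrite /dot !mulr0 !addr0. Qed.

Lemma dot_comb a b c x y :
  dot a (fun i => x * b i + y * c i) = x * dot a b + y * dot a c.
Proof. by rewrite /dot; ring. Qed.

Lemma dot_lincomb a (m : 'I_3 -> 'I_3 -> A) b :
  dot a (fun l => dot (m l) b) = dot b (fun i => dot a (m^~ i)).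
Proof. by rewrite /dot; ring. Qed.

Lemma cross_eq0_sym a b : (forall i, cross a b i = 0) ->
  forall i j, a i * b j = a j * b i.
Proof.
move=> ab0; have := ab0 i0; have := ab0 i1; have := ab0 i2.
rewrite /cross /= => /subr0_eq h2 /subr0_eq h1 /subr0_eq h0.
by do 2 apply: ord3_ind.
Qed.

End VectorCalculus.

Arguments eq_lincomb1 {A x y l m} c.
Arguments eq_lincomb2 {A x y x' y' l m} c c'.
Arguments eq_lincomb3 {A x y x' y' x2 y2 l m} c c' c2.

(** * A resolution by three syzygies and its relation *)

Section Resolution.
Variables (A : idomainType) (F g : 'I_3 -> A) (r : 'I_3 -> 'I_3 -> A).
Hypothesis F_neq0 : exists k, F k != 0.
Hypothesis F_cross : cross_exact F.
Hypothesis r_syz : forall i, dot (r i) F = 0.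
Hypothesis r_gen : forall v, dot v F = 0 -> exists t, forall l, v l = lincomb t r l.
Hypothesis g0F : forall l, cross (r i1) (r i2) l = g i0 * F l.
Hypothesis g1F : forall l, cross (r i2) (r i0) l = g i1 * F l.
Hypothesis g2F : forall l, cross (r i0) (r i1) l = g i2 * F l.

Let cancelF (x y : A) : (forall k, F k * x = F k * y) -> x = y.
Proof. by case: F_neq0 => k nz /(_ k)/(mulfI nz). Qed.

(** Cramer's rule. The matrix of rows [r i] kills [F], so its determinant
    vanishes, and by [g0F], [g1F], [g2F] its cofactors are the [g i * F m]. *)
Lemma relation_cofactors l : lincomb g r l = 0.
Proof.
have det0 : dot (cross (r i1) (r i2)) (r i0) = 0.
  rewrite /dot !g0F; apply: (eq_lincomb1 (g i0) (r_syz i0)); rewrite /dot; ring.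
apply: cancelF => m; rewrite mulr0.
have -> : F m * lincomb g r l = g i0 * F m * r i0 l + g i1 * F m * r i1 l
    + g i2 * F m * r i2 l by rewrite /lincomb /dot; ring.
rewrite -g0F -g1F -g2F.
by move: l m det0; do 2 apply: ord3_ind; rewrite /dot /cross /= => det0;
  first [ring | apply: (eq_lincomb1 1 det0); ring].
Qed.

Lemma cross_lincomb t t' l :
  cross (lincomb t r) (lincomb t' r) l = dot (cross t t') g * F l.
Proof.
have -> : dot (cross t t') g * F l = cross t t' i0 * (g i0 * F l)
  + cross t t' i1 * (g i1 * F l) + cross t t' i2 * (g i2 * F l).
  by rewrite /dot; ring.
rewrite -g0F -g1F -g2F.
by move: l; apply: ord3_ind; rewrite /lincomb /dot /cross /=; ring.
Qed.

(** The Koszul syzygies of [F] are combinations of the [r i], and the cross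
    product of two of them is a coordinate of [F] times [F]. *)
Lemma F_in_ideal_g : exists b, forall k, F k = dot (b k) g.
Proof.
have key e e' : exists b, dot (cross e e') F = dot b g.
  have [|t et] := @r_gen (cross e F); first by rewrite /dot /cross /=; ring.
  have [|t' et'] := @r_gen (cross e' F); first by rewrite /dot /cross /=; ring.
  exists (cross t t'); apply: cancelF => k; rewrite [RHS]mulrC -cross_lincomb.
  rewrite -(eq_cross et et').
  by move: k; apply: ord3_ind; rewrite /dot /cross /=; ring.
pose e k (i : 'I_3) : A := (i == k)%:R.
have [b0 e0] := key (e i1) (e i2).
have [b1 e1] := key (e i2) (e i0).
have [b2 e2] := key (e i0) (e i1).
exists (fun k => nth b0 [:: b0; b1; b2] k); apply: ord3_ind => /=.
- by rewrite -e0 /dot /cross /e /=; ring.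
- by rewrite -e1 /dot /cross /e /=; ring.
- by rewrite -e2 /dot /cross /e /=; ring.
Qed.

(** The ideal of [g] contains the coordinates of [F], so it inherits depth two. *)
Lemma g_cross : cross_exact g.
Proof.
have [b eb] := F_in_ideal_g => c gc0.
have Fc k i : F k * c i = dot (b k) c * g i.
  rewrite eb; move: (gc0 i0) (gc0 i1) (gc0 i2); rewrite /cross /dot /=.
  move: i; apply: ord3_ind => h0 h1 h2.
  - by apply: (eq_lincomb2 (b k i2) (- b k i1) h1 h2); ring.
  - by apply: (eq_lincomb2 (- b k i2) (b k i0) h0 h2); ring.
  - by apply: (eq_lincomb2 (b k i1) (- b k i0) h0 h1); ring.
have [i nzg] : exists i, g i != 0.
  case: F_neq0 => k; rewrite eb => nz; apply: contrapT => ng.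
  have g0 i : g i = 0 by apply/eqP; apply: contra_notT ng => ?; exists i.
  by move: nz; rewrite /dot !g0 !mulr0 !addr0 eqxx.
have [|p ep] := @F_cross (fun k => dot (b k) c).
  move=> m; apply: (mulIf nzg).
  have Fs j k : F j * dot (b k) c * g i = F k * dot (b j) c * g i.
    by rewrite -!mulrA -!Fc mulrCA.
  by move: m; apply: ord3_ind; rewrite /cross /= mulrBl mul0r Fs subrr.
by exists p => j; apply: cancelF => k; rewrite Fc ep; ring.
Qed.

(** A relation [c] between the [r i] satisfies [g x c = 0]: take its cross
    products with the [r j]. *)
Lemma relation_gen c : (forall l, lincomb c r l = 0) -> exists p, forall i, c i = p * g i.
Proof.
move=> c0; apply: g_cross => j; apply: cancelF => l; rewrite mulr0.
have rel i m : cross (lincomb c r) (r i) m = 0.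
  by move: m; apply: ord3_ind; rewrite /cross /= !c0 !mul0r subrr.
have -> : F l * cross g c j = cross (fun i => g i * F l) c j.
  by move: j; apply: ord3_ind; rewrite /cross /=; ring.
rewrite -(rel j l); move: j; apply: ord3_ind;
  rewrite [LHS]/cross /= -?g0F -?g1F -?g2F;
  by move: l; apply: ord3_ind; rewrite /lincomb /dot /cross /=; ring.
Qed.

(** The first syzygies of [g] are the Koszul ones, because the resolution
    [g], [r], [F] has length three. If [dot a g = 0] and [F k = dot (b k) g],
    then [w k = a x b k] satisfies [g x w k = F k * a]. Modulo [g] the vector
    [w k] turns out to be [F k * p'] for one vector [p'] independent of [k], and
    then [a = g x p'] after cancelling [F k]. *)
Lemma g_dot : dot_exact g.
Proof.
have [b eb] := F_in_ideal_g => a a0.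
pose w k := cross a (b k).
have gw k i : cross g (w k) i = F k * a i.
  rewrite eb; move: a0; rewrite /w /dot.
  by move: i; apply: ord3_ind => a0; rewrite /cross /=;
    [apply: (eq_lincomb1 (- b k i0) a0)|apply: (eq_lincomb1 (- b k i1) a0)
    |apply: (eq_lincomb1 (- b k i2) a0)]; ring.
(* [F j * w k - F k * w j] is killed by [g x -], hence a multiple of [g] *)
have sP m : exists s, forall i, cross F (w^~ i) m = s * g i.
  apply: g_cross => i.
  have -> : cross g (fun i => cross F (w^~ i) m) i
    = cross F (fun k => cross g (w k) i) m.
    by move: i m; do 2 apply: ord3_ind; rewrite /cross /=; ring.
  have -> : cross F (fun k => cross g (w k) i) m = cross F (fun k => F k * a i) m.
    by apply: eq_cross => // k; rewrite gw.
  by move: m; apply: ord3_ind; rewrite /cross /=; ring.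
(* applying [r] removes these multiples and leaves vectors parallel to [F] *)
have pP l : exists p, forall k, lincomb (w k) r l = p * F k.
  apply: F_cross => m; have [s es] := sP m.
  have -> : cross F (fun k => lincomb (w k) r l) m
      = dot (fun i => cross F (w^~ i) m) (r^~ l).
    by move: m {es}; apply: ord3_ind; rewrite /lincomb /dot /cross /=; ring.
  rewrite /dot !es; apply: (eq_lincomb1 s (relation_cofactors l)).
  by rewrite /lincomb /dot; ring.
have [p ep] := choice pP.
have [|p' ep'] := @r_gen p.
  apply: cancelF => k; rewrite mulr0.
  have -> : F k * dot p F = dot (lincomb (w k) r) F by rewrite /dot !ep; ring.
  have -> : dot (lincomb (w k) r) F
      = w k i0 * dot (r i0) F + w k i1 * dot (r i1) F + w k i2 * dot (r i2) F.
    by rewrite /lincomb /dot; ring.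
  by rewrite !r_syz !mulr0 !addr0.
have alP k : exists al, forall i, w k i - F k * p' i = al * g i.
  apply: relation_gen => l.
  have -> : lincomb (fun i => w k i - F k * p' i) r l
      = lincomb (w k) r l - F k * lincomb p' r l by rewrite /lincomb /dot; ring.
  by rewrite ep -ep' mulrC subrr.
exists p' => i; apply: cancelF => k; rewrite -gw.
have [al eal] := alP k.
have ew j : w k j = F k * p' j + al * g j by rewrite -eal addrC subrK.
by move: i; apply: ord3_ind; rewrite /cross /= !ew; ring.
Qed.

(** The map from the Koszul complex of [g] to the resolution [g], [r], [F]
    that is the identity in the two top degrees; [phi] and [u] are its
    components in the two lowest ones, and exist by Koszul exactness. *)
Lemma comparison_map : exists (phi : 'I_3 -> 'I_3 -> A) (u : A),
  (forall l i, r i l = cross g (phi l) i) /\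
  (forall i, dot F (phi^~ i) = u * g i).
Proof.
have phiP l : exists c, forall i, r i l = cross g c i.
  by apply: g_dot; have := relation_cofactors l; rewrite /lincomb /dot => <-; ring.
have [phi ephi] := choice phiP; exists phi.
have [|u eu] := @g_cross (fun i => dot F (phi^~ i)); last by exists u.
move=> i; have -> : cross g (fun i => dot F (phi^~ i)) i
    = dot (fun l => cross g (phi l) i) F.
  by move: i; apply: ord3_ind; rewrite /cross /dot /=; ring.
by rewrite /dot -!ephi; apply: r_syz.
Qed.

Section MappingCone.
Variables (phi : 'I_3 -> 'I_3 -> A) (u : A).
Hypothesis phiE : forall l i, r i l = cross g (phi l) i.
Hypothesis uE : forall i, dot F (phi^~ i) = u * g i.

Lemma dot_phi b : dot F (fun l => dot (phi l) b) = dot b g * u.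
Proof. by rewrite dot_lincomb (eq_dotr _ uE) /dot; ring. Qed.

(** If [s * u] is in the ideal of [F], the map of complexes multiplied by [s] is
    null-homotopic; the homotopy [t] writes [s] times the identity of the
    second term as a matrix with entries in the ideal of [g], and one diagonal
    entry gives the claim. *)
Lemma colon_u s v : s * u = dot F v -> exists b, s = dot b g.
Proof.
move=> sv.
have tP i : exists t, forall l, s * phi l i - v l * g i = lincomb t r l.
  apply: r_gen.
  have -> : dot (fun l => s * phi l i - v l * g i) F
     = s * dot F (phi^~ i) - g i * dot F v by rewrite /dot; ring.
  by rewrite uE -sv; ring.
have [t et] := choice tP.
have [|h eh] := @relation_gen
   (fun k => s * (k == i0)%:R - cross g (t^~ k) i0).
  move=> l.
  have -> : lincomb (fun k => s * (k == i0)%:R - cross g (t^~ k) i0) r l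
    = s * r i0 l - cross g (fun i => lincomb (t i) r l) i0.
    by rewrite /lincomb /cross /dot /=; ring.
  by rewrite phiE /cross /= -!et; ring.
exists (fun i => nth 0 [:: h; t i2 i0; - t i1 i0] i).
have := eh i0; rewrite /cross /dot /= => e.
by apply: (eq_lincomb1 1 e); ring.
Qed.

(** The mapping cone is exact: here and in the next lemma the vectors
    [(phi _ i, - g i)] generate the syzygies of [(F, u)], freely. *)
Lemma cone_syz s v : dot F v = s * u ->
  exists b, s = dot b g /\ forall l, v l = dot (phi l) b.
Proof.
move=> sv; have [b0 eb0] := colon_u (esym sv).
have [|t et] := @r_gen (fun l => v l - dot (phi l) b0).
  have -> : dot (fun l => v l - dot (phi l) b0) F
      = dot F v - dot F (fun l => dot (phi l) b0) by rewrite /dot; ring.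
  by rewrite sv dot_phi eb0 subrr.
exists (fun i => b0 i + cross t g i); split.
  by rewrite eb0 /dot /cross /=; ring.
move=> l; have := et l; rewrite /lincomb /dot !phiE /cross /= => e.
by apply: (eq_lincomb1 1 e); ring.
Qed.

Lemma cone_inj b : dot b g = 0 -> (forall l, dot (phi l) b = 0) -> forall i, b i = 0.
Proof.
move=> bg bphi; have [t et] := g_dot bg.
have [|h eh] := @relation_gen t.
  move=> l; have := bphi l; rewrite /lincomb /dot !et !phiE /cross /= => e.
  by apply: (eq_lincomb1 (-1) e); ring.
by move=> i; rewrite et; move: i; apply: ord3_ind; rewrite /cross /= !eh; ring.
Qed.

(** A module over three variables with a free resolution of length two has no
    element killed by all variables. Concretely, representations [V i], [s i]
    of the [x i * y] are corrected by syzygies, using that the Koszul complex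
    of [x] is exact, until they are multiples of the [x i]. *)
Lemma cone_saturated (x : 'I_3 -> A) (y : A) :
  (exists k, x k != 0) -> cross_exact x -> dot_exact x ->
  (forall i, exists v s, x i * y = dot F v + s * u) ->
  exists v s, y = dot F v + s * u.
Proof.
move=> [k0 nzx] xcross xdot xy.
have [V VP] := choice xy; have [s es] := choice VP => {VP}.
have CP m : exists c, - cross x s m = dot c g /\
    forall l, cross x (V^~ l) m = dot (phi l) c.
  apply: cone_syz.
  have -> : dot F (fun l => cross x (V^~ l) m) = cross x (fun k => dot F (V k)) m.
    by move: m; apply: ord3_ind; rewrite /cross /dot /=; ring.
  have eV k : dot F (V k) = x k * y - s k * u by rewrite es addrK.
  by move: m; apply: ord3_ind; rewrite /cross /= !eV; ring.
have [C CP'] := choice CP.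
have xC i : dot (C^~ i) x = 0.
  apply: (@cone_inj (fun i => dot (C^~ i) x)) => [|l].
    have -> : dot (fun i => dot (C^~ i) x) g
      = dot (C i0) g * x i0 + dot (C i1) g * x i1 + dot (C i2) g * x i2.
      by rewrite /dot; ring.
    by rewrite -!(CP' _).1 /cross /=; ring.
  have -> : dot (phi l) (fun i => dot (C^~ i) x)
      = dot (phi l) (C i0) * x i0 + dot (phi l) (C i1) * x i1 + dot (phi l) (C i2) * x i2.
    by rewrite /dot; ring.
  by rewrite -!(CP' _).2 /cross /=; ring.
have EP i : exists e, forall m, C m i = cross x e m by apply: xdot.
have [E eE] := choice EP.
have WP l : exists w, forall k, V k l - dot (phi l) (E^~ k) = w * x k.
  apply: xcross => m.
  have -> : cross x (fun k => V k l - dot (phi l) (E^~ k)) m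
     = cross x (V^~ l) m - dot (phi l) (fun i => cross x (E i) m).
    by move: m; apply: ord3_ind; rewrite /cross /dot /=; ring.
  by rewrite (CP' m).2 /dot !eE subrr.
have [W eW] := choice WP.
have [|W' eW'] := @xcross (fun k => - s k - dot g (E^~ k)).
  move=> m.
  have -> : cross x (fun k => - s k - dot g (E^~ k)) m
     = - cross x s m - dot (fun i => cross x (E i) m) g.
    by move: m; apply: ord3_ind; rewrite /cross /dot /=; ring.
  by rewrite (CP' m).1 /dot !eE subrr.
exists W, (- W'); apply: (mulfI nzx); rewrite es.
have eV l : V k0 l = W l * x k0 + dot (phi l) (E^~ k0) by rewrite -eW subrK.
have e's : s k0 = - (W' * x k0 + dot g (E^~ k0)) by rewrite -eW' subrK opprK.
rewrite e's {1}/dot !eV.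
have := uE i0; have := uE i1; have := uE i2; rewrite /dot => h2 h1 h0.
by apply: (eq_lincomb3 (E i0 k0) (E i1 k0) (E i2 k0) h0 h1 h2); ring.
Qed.

End MappingCone.

End Resolution.

(** * Dimensions of quotients *)

Section QuotientDimension.
Variables (K : fieldType).

Definition submodule (V : lmodType K) (P : V -> Prop) : Prop :=
  P 0 /\ forall (a : K) u v, P u -> P v -> P (a *: u + v).

(** [quotient_dim P Q n] reads dim P / (P :&: Q) = n. Stating it through
    representatives avoids building the quotient, and allows [P] to sit in an
    infinite-dimensional space. *)
Definition quotient_dim (V : lmodType K) (P Q : V -> Prop) (n : nat) : Prop :=
  exists b : 'I_n -> V, (forall i, P (b i)) /\
    forall v, P v -> exists! c : 'rV[K]_n, Q (v - \sum_(i < n) c 0 i *: b i).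

Section Submodule.
Variables (V : lmodType K) (P : V -> Prop).
Hypothesis sP : submodule P.

Lemma submodule0 : P 0. Proof. by case: sP. Qed.

Lemma submoduleD u v : P u -> P v -> P (u + v).
Proof. by case: sP => _ PD Pu Pv; rewrite -[u]scale1r; apply: PD. Qed.

Lemma submoduleZ a u : P u -> P (a *: u).
Proof. by case: sP => P0 PD Pu; rewrite -[_ *: _]addr0; apply: PD. Qed.

Lemma submoduleN u : P u -> P (- u).
Proof. by rewrite -scaleN1r; apply: submoduleZ. Qed.

Lemma submoduleB u v : P u -> P v -> P (u - v).
Proof. by move=> Pu Pv; apply/submoduleD/submoduleN. Qed.

Lemma submodule_sum (I : finType) (F : I -> V) :
  (forall i, P (F i)) -> P (\sum_i F i).
Proof. by move=> PF; apply: big_ind => //; [apply: submodule0|apply: submoduleD]. Qed.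

End Submodule.

Section Combinations.
Variable V : lmodType K.

Definition comb n (b : 'I_n -> V) (c : 'rV[K]_n) : V := \sum_(i < n) c 0 i *: b i.

Lemma combD n (b : 'I_n -> V) c c' : comb b (c + c') = comb b c + comb b c'.
Proof. by rewrite /comb -big_split; apply: eq_bigr => i _; rewrite mxE scalerDl. Qed.

Lemma combN n (b : 'I_n -> V) c : comb b (- c) = - comb b c.
Proof. by rewrite /comb -sumrN; apply: eq_bigr => i _; rewrite mxE scaleNr. Qed.

Lemma combB n (b : 'I_n -> V) c c' : comb b (c - c') = comb b c - comb b c'.
Proof. by rewrite combD combN. Qed.

Lemma comb0 n (b : 'I_n -> V) : comb b 0 = 0.
Proof. by rewrite /comb big1 // => i _; rewrite mxE scale0r. Qed.

Lemma comb_mulmx n m (b : 'I_n -> V) (M : 'M[K]_(m, n)) c :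
  comb b (c *m M) = comb (fun j => comb b (row j M)) c.
Proof.
rewrite /comb; transitivity (\sum_i \sum_j (c 0 j * M j i) *: b i).
  by apply: eq_bigr => i _; rewrite mxE scaler_suml.
rewrite exchange_big; apply: eq_bigr => j _; rewrite scaler_sumr.
by apply: eq_bigr => i _; rewrite mxE scalerA.
Qed.

Lemma submodule_comb (P : V -> Prop) n (b : 'I_n -> V) c :
  submodule P -> (forall i, P (b i)) -> P (comb b c).
Proof. by move=> sP Pb; apply: (submodule_sum sP) => i; apply: submoduleZ. Qed.

Lemma comb_free (P Q : V -> Prop) n (b : 'I_n -> V) : submodule P -> submodule Q ->
  (forall i, P (b i)) ->
  (forall v, P v -> exists! c, Q (v - comb b c)) ->
  forall c, Q (comb b c) -> c = 0.
Proof.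
move=> sP sQ Pb bP c Qc; have [c' [_ uc']] := bP _ (submodule_comb c sP Pb).
by rewrite -(uc' c) ?(uc' 0) // ?comb0 ?subr0 // subrr; apply: submodule0.
Qed.

End Combinations.

(** Coordinates modulo [Q]: this reduces the dimension count to matrices. *)
Lemma coord_matrix (V : lmodType K) (P Q : V -> Prop) n m (b : 'I_n -> V)
    (b' : 'I_m -> V) : submodule Q ->
  (forall v, P v -> exists! c : 'rV_n, Q (v - comb b c)) -> (forall j, P (b' j)) ->
  exists M : 'M[K]_(m, n), forall c, Q (comb b' c - comb b (c *m M)).
Proof.
move=> sQ bP Pb'.
have MP j : exists c : 'rV_n, Q (b' j - comb b c).
  by have [c [Qc _]] := bP _ (Pb' j); exists c.
have [M eM] := choice MP; exists (\matrix_j M j) => c.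
rewrite comb_mulmx /comb -sumrB; apply: submodule_sum => // j.
by rewrite -scalerBr; apply: submoduleZ => //; rewrite rowK; apply: eM.
Qed.

Lemma quotient_dim_le (V : lmodType K) (P Q : V -> Prop) n m :
  submodule P -> submodule Q ->
  quotient_dim P Q n -> quotient_dim P Q m -> (n <= m)%N.
Proof.
move=> sP sQ [b [Pb bP]] [b' [Pb' bP']].
have [M eM] := coord_matrix sQ bP Pb'.
have [N eN] := coord_matrix sQ bP' Pb.
apply: (@mulmx1_min _ _ _ N M); apply/row_matrixP => i.
apply: subr0_eq; rewrite -linearB /=.
apply: (comb_free sP sQ Pb bP); rewrite raddfB /= combB rowE row1 -opprB.
apply: (submoduleN sQ).
rewrite -(subrK (comb b' (delta_mx 0 i *m N)) (comb b _)) -addrA.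
apply: (submoduleD sQ); first exact: eN.
by rewrite mulmxA; apply: eM.
Qed.

Lemma quotient_dim_uniq (V : lmodType K) (P Q : V -> Prop) n m :
  submodule P -> submodule Q ->
  quotient_dim P Q n -> quotient_dim P Q m -> n = m.
Proof.
by move=> sP sQ dn dm; apply/eqP; rewrite eqn_leq; apply/andP; split;
  apply: (quotient_dim_le sP sQ).
Qed.

Lemma quotient_dim0 (V : lmodType K) (P Q : V -> Prop) v :
  quotient_dim P Q 0 -> P v -> Q v.
Proof. by case=> b [_ bP] /bP[c []]; rewrite big_ord0 subr0. Qed.

(** Coordinates of a basis of [P'] modulo [Q] form a matrix [M] with free rows;
    a complement of its row space is a basis of [P] modulo [P']. *)
Lemma quotient_dim_sub (V : lmodType K) (P P' Q : V -> Prop) n m :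
  submodule P -> submodule P' -> submodule Q -> (forall v, Q v -> P' v) ->
  quotient_dim P Q n -> quotient_dim (fun v => P v /\ P' v) Q m ->
  (m <= n)%N /\ quotient_dim P P' (n - m).
Proof.
move=> sP sP' sQ QP' [b [Pb bP]] [b' [Pb' bP']].
have sPP' : submodule (fun v => P v /\ P' v).
  split; first by split; apply: submodule0.
  by move=> a u v [Pu P'u] [Pv P'v]; split; [case: sP|case: sP'] => _; apply.
have [M eM] := coord_matrix sQ bP (fun j => (Pb' j).1).
have freeM : row_free M.
  apply/inj_row_free => x xM; apply: (comb_free sPP' sQ Pb' bP').
  by have := eM x; rewrite xM comb0 subr0.
have lemn : (m <= n)%N by rewrite -(eqP freeM); apply: rank_leq_col.
split=> //; have <- : \rank M^C%MS = (n - m)%N by rewrite mxrank_compl (eqP freeM).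
pose N := row_base M^C%MS.
exists (fun i => comb b (row i N)); split=> [i|v Pv]; first exact: submodule_comb.
have [c [Qc _]] := bP v Pv.
have [[x1 x2] /= ex] : exists x : 'rV_m * 'rV_(\rank M^C%MS), c = x.1 *m M + x.2 *m N.
  have : (c <= M + N)%MS.
    rewrite (adds_eqmx (eqmx_refl M) (eq_row_base _)).
    exact/submx_full/addsmx_compl_full.
  by case/sub_addsmxP => -[y1 y2] /= ->; exists (y1, y2).
have P'v : P' (v - comb (fun i => comb b (row i N)) x2).
  have -> : v - comb (fun i => comb b (row i N)) x2
     = (v - comb b c) - (comb b' x1 - comb b (x1 *m M)) + comb b' x1.
    by rewrite -comb_mulmx ex combD; set p := comb b _; set q := comb b _;
       rewrite opprB addrA (addrAC _ (- _)) addrK opprD addrA addrAC addrNK.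
  apply: (submoduleD sP'); last by apply: submodule_comb => // j; case: (Pb' j).
  by apply: QP'; apply: (submoduleB sQ).
exists x2; split=> [//|y P'y].
pose w := comb b ((x2 - y) *m N).
have wE : w = (v - comb b (y *m N)) - (v - comb b (x2 *m N)).
  by rewrite /w mulmxBl combB opprB [RHS]addrC addrA subrK.
have PP'w : P w /\ P' w.
  split; first exact: submodule_comb.
  by rewrite wE; apply: (submoduleB sP'); rewrite comb_mulmx.
have [z [Qz _]] := bP' w PP'w.
have xyz : (x2 - y) *m N = z *m M.
  apply: subr0_eq; apply: (comb_free sP sQ Pb bP); rewrite combB -/w.
  by rewrite -(subrK (comb b' z) w) -addrA; apply: (submoduleD sQ).
apply/eqP; rewrite -subr_eq0; apply/eqP.
apply: (row_free_inj (row_base_free M^C%MS)); rewrite mul0mx.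
apply/eqP; rewrite -submx0 -(capmx_compl M) sub_capmx xyz submxMl -xyz /=.
by apply: submx_trans (submxMl _ _) _; rewrite eq_row_base.
Qed.

Lemma quotient_dim_iso (V V' : lmodType K) (phi : {linear V -> V'})
  (P Q : V -> Prop) (P' Q' : V' -> Prop) n : submodule Q' -> submodule P ->
  (forall v, P v -> P' (phi v)) -> (forall v, Q v -> Q' (phi v)) ->
  (forall v, P v -> Q' (phi v) -> Q v) ->
  (forall w, P' w -> exists v, P v /\ Q' (w - phi v)) ->
  quotient_dim P Q n -> quotient_dim P' Q' n.
Proof.
move=> sQ' sP PP' QQ' inj surj [b [Pb bP]].
exists (phi \o b); split=> [i|w /surj[v [Pv Q'v]]]; first exact: PP'.
have [c [Qc uc]] := bP v Pv.
have phic (c' : 'rV[K]_n) : \sum_(i < n) c' 0 i *: (phi \o b) i = phi (comb b c').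
  by rewrite linear_sum; apply: eq_bigr => i _; rewrite linearZ.
exists c; split=> [|c']; rewrite phic.
  rewrite -(subrK (phi v) w) -addrA -linearB.
  by apply: (submoduleD sQ') => //; apply: QQ'.
move=> Q'c'; apply: uc; apply: inj.
  by apply: (submoduleB sP) => //; apply: submodule_comb.
have -> : phi (v - comb b c') = (w - phi (comb b c')) - (w - phi v).
  by rewrite linearB opprB [RHS]addrC addrA subrK.
exact: (submoduleB sQ').
Qed.

End QuotientDimension.

(** * Graded ideals of the polynomial ring in three variables *)

Section Grading.
Variable K : fieldType.
Local Notation S := {mpoly K[3]}.
Implicit Types p q g v : S.

(** Homogeneous components, indexed by integers so that degree shifts need no
    case distinction. *)
Definition component (k : int) (p : S) : S :=
  if k is Posz n then pihomog mdeg n p else 0.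

Fact component_is_linear k : linear (component k).
Proof. by case: k => n a p q /=; [rewrite linearP|rewrite scaler0 addr0]. Qed.

HB.instance Definition _ k := GRing.isLinear.Build K S S _ (component k)
  (component_is_linear k).

Lemma componentD k p q : component k (p + q) = component k p + component k q.
Proof. exact: raddfD. Qed.

Lemma componentB k p q : component k (p - q) = component k p - component k q.
Proof. exact: raddfB. Qed.

Definition homogeneous (k : int) (p : S) : Prop := component k p = p.

Lemma homogeneousE (n : nat) p : homogeneous n p <-> p \is n.-homog.
Proof. by rewrite homog_piE; split=> [/eqP|/eqP]. Qed.

Lemma homogeneous_neg n p : homogeneous (Negz n) p -> p = 0.
Proof. by move=> <-. Qed.

Lemma homogeneous_lt0 k p : k < 0 -> homogeneous k p -> p = 0.
Proof. by case: k => // n _ /homogeneous_neg. Qed.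

Lemma component_lt0 k p : k < 0 -> component k p = 0.
Proof. by case: k. Qed.

Lemma component_homog (k : int) (n : nat) p : p \is n.-homog ->
  component k p = if k == n then p else 0.
Proof.
case: k => m hp //=; have [[->]|nmn] := eqVneq; first exact: pihomog_dE.
by apply: pihomog_ne0 hp; apply: contraNneq nmn => ->.
Qed.

Lemma homogeneous_component k p : homogeneous k (component k p).
Proof. by case: k => n //; apply/homogeneousE/pihomogP. Qed.

Lemma componentM (a k : int) g p : homogeneous a g ->
  component k (g * p) = g * component (k - a) p.
Proof.
case: a => [a /homogeneousE hg|a /homogeneous_neg ->]; last by rewrite !mul0r raddf0.
rewrite {1 2}(pihomog_partitionE (leqnn (mmeasure mdeg p))).
rewrite mulr_sumr !linear_sum mulr_sumr; apply: eq_bigr => d _ /=.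
have hd := pihomogP mdeg d p.
rewrite (component_homog _ hd) (component_homog _ (dhomogM hg hd)).
rewrite [k - _ == _](_ : _ = (k == (a + d)%N)); first by case: ifP; rewrite ?mulr0.
by apply/eqP/eqP; lia.
Qed.

Lemma homogeneousM a b g p : homogeneous a g -> homogeneous b p ->
  homogeneous (a + b) (g * p).
Proof. by move=> hg hp; rewrite /homogeneous (componentM _ _ hg) addrAC subrr add0r hp. Qed.

Lemma homogeneous_submodule k : submodule (homogeneous k).
Proof.
split=> [|a u v hu hv]; first exact: raddf0.
by rewrite /homogeneous linearP /= hu hv.
Qed.

Lemma homogeneousB k p q : homogeneous k p -> homogeneous k q -> homogeneous k (p - q).
Proof. exact: (submoduleB (homogeneous_submodule k)). Qed.

Lemma component_dot (a k : int) (F v : 'I_3 -> S) : (forall i, homogeneous a (F i)) ->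
  component k (dot F v) = dot F (fun i => component (k - a) (v i)).
Proof. by move=> hF; rewrite /dot !componentD !(componentM _ _ (hF _)). Qed.

Definition forms_dim (k : int) : nat := if k is Posz n then 'C(n + 2, 2) else 0.

Lemma homogeneous_dim k :
  quotient_dim (homogeneous k) (fun v : S => v = 0) (forms_dim k).
Proof.
case: k => [n|n] /=; last first.
  exists (fun _ => 0); split=> [[]//|v /homogeneous_neg ->]; exists 0.
  by split=> [|c _]; [rewrite big_ord0 subr0|apply/rowP; case].
rewrite -bin_sub ?leq_addl // addnK.
have [phi phi_lin [psi phiK psiK]] := @dhomog_vecaxiom 2 K n.
have phiZD a x y : phi (a *: x + y) = a *: phi x + phi y by apply: phi_lin.
have phi0 : phi 0 = 0 by have := phiZD (-1) 0 0; rewrite !scaleN1r !addNr.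
have phiD x y : phi (x + y) = phi x + phi y.
  by have := phiZD 1 x y; rewrite !scale1r.
have phiZ a x : phi (a *: x) = a *: phi x by rewrite -[_ *: x]addr0 phiZD phi0 addr0.
pose b i : dhomog 3 K n := psi (delta_mx 0 i).
have phib (c : 'rV_('C(n + 2, n))) : phi (\sum_i c 0 i *: b i) = c.
  rewrite (big_morph phi phiD phi0) [RHS]row_sum_delta; apply: eq_bigr => i _.
  by rewrite phiZ psiK.
exists (fun i => b i : S); split=> [i|v /homogeneousE hv].
  exact/homogeneousE/dhomog_is_dhomog.
pose v' : dhomog 3 K n := DHomog hv.
have valE (c : 'rV_('C(n + 2, n))) :
    \sum_i c 0 i *: (b i : S) = (\sum_i c 0 i *: b i : dhomog 3 K n).
  by rewrite linear_sum.
exists (phi v'); split=> [|c]; rewrite valE.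
  have -> : \sum_i (phi v') 0 i *: b i = v' by apply: (can_inj phiK); rewrite phib.
  by rewrite subrr.
move=> /subr0_eq evc; rewrite -(phib c); congr phi; exact: val_inj.
Qed.

(** ** Ideals built one generator at a time *)

Definition graded (I : S -> Prop) : Prop :=
  submodule I /\ forall k v, I v -> I (component k v).

Definition adjoin (I : S -> Prop) (g v : S) : Prop := exists s, I (v - g * s).

Lemma graded_zero : graded (fun v => v = 0).
Proof.
split=> [|k v ->]; last exact: raddf0.
by split=> // a u v -> ->; rewrite scaler0 addr0.
Qed.

Lemma graded_adjoin I g a : homogeneous a g -> graded I -> graded (adjoin I g).
Proof.
move=> hg [sI gI]; split; first split.
- by exists 0; rewrite mulr0 subr0; apply: submodule0.
- move=> c u v [s Is] [t It]; exists (c *: s + t).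
  have -> : c *: u + v - g * (c *: s + t) = c *: (u - g * s) + (v - g * t).
    by rewrite mulrDr -scalerAr opprD scalerBr addrACA.
  by case: sI => _; apply.
move=> k v [s Is]; exists (component (k - a) s).
by rewrite -(componentM _ _ hg) -raddfB; apply: gI.
Qed.

(** Multiplication by a nonzerodivisor [g] identifies [S / I], shifted by the
    degree of [g], with the kernel of the projection from [S / I] to
    [S / (I + g)]. *)
Lemma hilbert_adjoin (I : S -> Prop) g (a : int) (h : int -> nat) :
  graded I -> homogeneous a g ->
  (forall k s, homogeneous k s -> I (g * s) -> I s) ->
  (forall s, I s -> I (g * s)) ->
  (forall k, quotient_dim (homogeneous k) I (h k)) ->
  forall k, (h (k - a)%R <= h k)%N /\
    quotient_dim (homogeneous k) (adjoin I g) (h k - h (k - a)%R)%N.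
Proof.
move=> gI hg regI mulI hI k; have [sI cI] := gI.
apply: (quotient_dim_sub (homogeneous_submodule k) (graded_adjoin hg gI).1 sI _ (hI k)).
  by move=> v Iv; exists 0; rewrite mulr0 subr0.
apply: (quotient_dim_iso (phi := g \*o idfun) sI (homogeneous_submodule (k - a)) _ _ _ _ (hI _)).
- move=> v hv; split; last by exists v; rewrite subrr; apply: submodule0.
  by have := homogeneousM hg hv; rewrite addrC subrK.
- by move=> v; apply: mulI.
- by move=> v; apply: regI.
move=> w [hw [s Is]]; exists (component (k - a) s).
split; first exact: homogeneous_component.
change (I (w - g * component (k - a) s)).
by rewrite -(componentM _ _ hg) -{1}hw -raddfB; apply: cI.
Qed.

(** ** The Hilbert function of a complete intersection *)

Section CompleteIntersection.
Variables (g : 'I_3 -> S) (c : 'I_3 -> int).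
Hypothesis gc : forall i, homogeneous (c i) (g i).
Hypothesis c_gt0 : forall i, 0 < c i.
Hypothesis g_dot : dot_exact g.

(** Otherwise the third unit vector would be a syzygy, and [1] would lie in the
    ideal of the other two generators, which have positive degree. *)
Lemma regular_first : g i2 != 0.
Proof.
apply/eqP => g20; have [|e ee] := @g_dot (fun i => (i == i2)%:R).
  by rewrite /dot /= g20; ring.
have e1 : 1 = g i0 * e i1 - g i1 * e i0 := ee i2.
have h1 : homogeneous 0 (1 : S) by apply/homogeneousE/dhomog1.
move: h1; rewrite e1 /homogeneous componentB.
rewrite (componentM _ _ (gc i0)) (componentM _ _ (gc i1)).
rewrite !component_lt0 ?sub0r ?oppr_lt0 // !mulr0 subr0 -e1 => /esym/eqP.
by rewrite oner_eq0.
Qed.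

(** A syzygy of two of the generators is, by exactness, a Koszul syzygy plus
    [g i0] times another syzygy; the degree drops, so descent applies. *)
Lemma regular_second k a1 a2 : homogeneous k a1 -> homogeneous (k + c i1 - c i2) a2 ->
  g i1 * a1 + g i2 * a2 = 0 -> exists h, a1 = g i2 * h /\ a2 = - (g i1 * h).
Proof.
have g2nz := regular_first.
have neg j x y : j < 0 -> homogeneous j x -> g i1 * x + g i2 * y = 0 ->
    exists h, x = g i2 * h /\ y = - (g i1 * h).
  move=> /homogeneous_lt0 + hx => /(_ _ hx) ->; rewrite mulr0 add0r => /eqP.
  rewrite mulf_eq0 (negPf g2nz) /= => /eqP ->; exists 0.
  by rewrite !mulr0 oppr0.
have [n] : exists n : nat, k < n%:Z by exists `|k|.+1%N; lia.
elim: n k a1 a2 => [|n IHn] k a1 a2 ltkn h1 h2 a12; first exact: neg ltkn h1 a12.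
have [|e ee] := @g_dot (fun i => nth 0 [:: 0; a1; a2] i).
  by rewrite /dot /= mul0r add0r -a12; ring.
have := ee i0; have := ee i1; have := ee i2; rewrite /cross /= => e2 e1 e0.
pose x0 := component (k - c i2) (e i0).
pose x1 := component (k + c i1 - c i2 - c i0) (e i1).
pose x2 := component (k - c i0) (e i2).
have f0 : g i1 * x2 - g i2 * x1 = 0.
  have := congr1 (component (k + c i1 - c i0)) e0.
  rewrite raddf0 componentB (componentM _ _ (gc i1)) (componentM _ _ (gc i2)) => ->.
  by rewrite /x1 /x2; congr (g i1 * component _ _ - g i2 * component _ _); lia.
have f1 : a1 = g i2 * x0 - g i0 * x2.
  rewrite -h1 e1 componentB (componentM _ _ (gc i2)) (componentM _ _ (gc i0)).
  by [].
have f2 : a2 = g i0 * x1 - g i1 * x0.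
  rewrite -h2 e2 componentB (componentM _ _ (gc i0)) (componentM _ _ (gc i1)).
  by congr (_ - g i1 * component _ _); lia.
have [||||h [ex2 ex1]] := IHn (k - c i0) x2 (- x1).
- by have := c_gt0 i0; lia.
- exact: homogeneous_component.
- apply: (submoduleN (homogeneous_submodule _)).
  have -> : k - c i0 + c i1 - c i2 = k + c i1 - c i2 - c i0 by lia.
  exact: homogeneous_component.
- by rewrite mulrN.
exists (x0 - g i0 * h); split; first by rewrite f1 ex2; ring.
by rewrite f2 -[x1]opprK ex1; ring.
Qed.

Lemma regular_third s s1 s2 : g i0 * s = g i1 * s1 + g i2 * s2 ->
  exists t1 t2, s = g i1 * t1 + g i2 * t2.
Proof.
move=> e; have [|f ef] := @g_dot (fun i => nth 0 [:: s; - s1; - s2] i).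
  by rewrite /dot /=; apply: (eq_lincomb1 1 e); ring.
exists (f i2), (- f i1); have := ef i0; rewrite /cross /= => ->; ring.
Qed.

Lemma complete_intersection_hilbert :
  let h1 k := (forms_dim k - forms_dim (k - c i2)%R)%N in
  let h2 k := (h1 k - h1 (k - c i1)%R)%N in
  forall k, quotient_dim (homogeneous k) (fun v => exists b, v = dot b g)
    (h2 k - h2 (k - c i0)%R)%N.
Proof.
move=> h1 h2 k.
have I0 := graded_zero.
have reg1 j s : homogeneous j s -> g i2 * s = 0 -> s = 0.
  by move=> _ /eqP; rewrite mulf_eq0 (negPf regular_first) => /eqP.
have mul1 s : s = 0 -> g i2 * s = 0 by move=> ->; rewrite mulr0.
have reg2 j s : homogeneous j s -> adjoin (fun v => v = 0) (g i2) (g i1 * s) ->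
    adjoin (fun v => v = 0) (g i2) s.
  move=> hs [t et]; pose t' := component (j + c i1 - c i2) t.
  have et' : g i1 * s = g i2 * t'.
    rewrite -(componentM _ _ (gc i2)) -(subr0_eq et) addrC.
    by apply/esym; apply: homogeneousM.
  have [||h [-> _]] := @regular_second j s (- t') hs.
  - apply: (submoduleN (homogeneous_submodule _)); exact: homogeneous_component.
  - by rewrite et'; ring.
  by exists h; rewrite subrr.
have mul2 s : adjoin (fun v => v = 0) (g i2) s -> adjoin (fun v => v = 0) (g i2) (g i1 * s).
  by move=> [t /subr0_eq ->]; exists (g i1 * t); ring.
have reg3 j s : homogeneous j s ->
    adjoin (adjoin (fun v => v = 0) (g i2)) (g i1) (g i0 * s) ->
    adjoin (adjoin (fun v => v = 0) (g i2)) (g i1) s.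
  move=> _ [t1 [t2 e]]; have [|r1 [r2 ->]] := @regular_third s t1 t2.
    by apply: (eq_lincomb1 1 e); ring.
  by exists r1, r2; ring.
have mul3 s : adjoin (adjoin (fun v => v = 0) (g i2)) (g i1) s ->
    adjoin (adjoin (fun v => v = 0) (g i2)) (g i1) (g i0 * s).
  move=> [t1 [t2 e]]; exists (g i0 * t1), (g i0 * t2).
  by apply: (eq_lincomb1 (g i0) e); ring.
have I1 := graded_adjoin (gc i2) I0.
have I2 := graded_adjoin (gc i1) I1.
have dim1 j := (hilbert_adjoin I0 (gc i2) reg1 mul1 homogeneous_dim j).2.
have dim2 j := (hilbert_adjoin I1 (gc i1) reg2 mul2 dim1 j).2.
have := (hilbert_adjoin I2 (gc i0) reg3 mul3 dim2 k).2.
rewrite (_ : adjoin _ _ = (fun v => exists b, v = dot b g)) //.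
apply/funext => v; apply/propext; split.
  move=> [s [t [w e]]]; exists (fun i => nth 0 [:: s; t; w] i).
  by apply: (eq_lincomb1 1 e); rewrite /dot /=; ring.
by move=> [b ->]; exists (b i0), (b i1), (b i2); rewrite /dot; ring.
Qed.

End CompleteIntersection.

(** Multiplying the Hilbert series [1 / (1 - t)^3] of the polynomial ring by
    [(1 - t^2) (1 - t^p) (1 - t^q)] yields
    [(1 + t) (1 + ... + t^(p - 1)) (1 + ... + t^(q - 1))]; its coefficients
    increase in steps of two up to a plateau. *)
Lemma hilbert_function_bounds (p q : int) : 2 <= p -> p <= q ->
  let h1 k := (forms_dim k - forms_dim (k - 2)%R)%N in
  let h2 k := (h1 k - h1 (k - p)%R)%N in
  let h3 k := (h2 k - h2 (k - q)%R)%N in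
  let M := if p == q then 2 * p - 1 else 2 * p in
  [/\ forall k, (h3 k)%:Z <= M, (h3 (if p == q then p - 1 else p))%:Z = M
    & forall k, p + q <= k -> h3 k = 0%N].
Proof.
move=> p2 pq h1 h2 h3 M.
have h1E k : (h1 k)%:Z = if k < 0 then 0 else 2 * k + 1.
  rewrite /h1; case: k => // -[|[|n]] //.
  rewrite (_ : Posz n.+2 - 2 = Posz n); last by lia.
  rewrite /forms_dim !addSn !(binS, bin1, bin0) /=; lia.
have h2E k : (h2 k)%:Z = if k < 0 then 0 else if k < p then 2 * k + 1 else 2 * p.
  have := h1E k; have := h1E (k - p); rewrite /h2; move: (h1 k) (h1 (k - p)) => x y.
  by do ![case: ifP]; lia.
have h3E k : (h3 k)%:Z = if k < 0 then 0 else if k < p then 2 * k + 1 else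
    if k < q then 2 * p else if k < p + q then 2 * p - 2 * (k - q) - 1 else 0.
  have := h2E k; have := h2E (k - q); rewrite /h3; move: (h2 k) (h2 (k - q)) => x y.
  by do ![case: ifP]; lia.
split=> [k| |k lk].
- by rewrite h3E /M; do ![case: ifP]; lia.
- by rewrite h3E /M; do ![case: ifP]; lia.
- by have := h3E k; do ![case: ifP]; lia.
Qed.

End Grading.

Arguments component : simpl never.
Arguments homogeneous_submodule {K} k.

(** * The coordinates form a regular sequence *)

Section Coordinates.
Variable K : fieldType.
Local Notation S := {mpoly K[3]}.

Definition kill_var (i : 'I_3) : S -> S :=
  mmap (@mpolyC 3 K) (fun j => if j == i then 0 else 'X_j).

HB.instance Definition _ i := GRing.RMorphism.copy (kill_var i)
  (mmap (@mpolyC 3 K) (fun j => if j == i then 0 else 'X_j : S)).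

Lemma kill_varX i j : kill_var i 'X_j = if j == i then 0 else 'X_j.
Proof. by rewrite /kill_var mmapX mmap1U. Qed.

Lemma kill_varD i : {morph kill_var i : p q / p + q}. Proof. exact: rmorphD. Qed.
Lemma kill_varB i : {morph kill_var i : p q / p - q}. Proof. exact: rmorphB. Qed.
Lemma kill_varM i : {morph kill_var i : p q / p * q}. Proof. exact: rmorphM. Qed.
Lemma kill_var0 i : kill_var i 0 = 0. Proof. exact: rmorph0. Qed.
Lemma kill_var1 i : kill_var i 1 = 1. Proof. exact: rmorph1. Qed.

Lemma kill_varE i (p : S) : exists q, p = 'X_i * q + kill_var i p.
Proof.
elim/mpolyind: p => [|c m p _ _ [q eq]]; first by exists 0; rewrite kill_var0 mulr0 addr0.
have [r er] : exists r, 'X_[m] = 'X_i * r + kill_var i 'X_[m].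
  rewrite mpolyXE_id; elim/big_ind: _ => [|a b [r er] [s es]|j _].
  - by exists 0; rewrite kill_var1 mulr0 add0r.
  - exists (r * b + kill_var i a * s).
    by rewrite kill_varM {1}er mulrDl {2}es; ring.
  elim: (m j) => [|n [r er]]; first by exists 0; rewrite expr0 kill_var1 mulr0 add0r.
  rewrite exprS kill_varM; have [eji|nji] := eqVneq j i.
    by exists ('X_j ^+ n); rewrite kill_varX eji eqxx mul0r addr0.
  exists ('X_j * r); rewrite kill_varX (negPf nji) {1}er; ring.
exists (c%:MP * r + q).
rewrite -mul_mpolyC kill_varD kill_varM {1}er {1}eq.
have -> : kill_var i c%:MP = c%:MP by rewrite /kill_var mmapC.
ring.
Qed.

Lemma mpolyX_neq0 (i : 'I_3) : 'X_i != 0 :> S.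
Proof. by rewrite -msize_poly_eq0 msizeX. Qed.

(** Setting a variable to zero in the syzygy shows that a component is divisible
    by that variable; the same method gives [coordinates_dot]. *)
Lemma coordinates_cross : cross_exact (fun i => 'X_i : S).
Proof.
move=> a ha; have := ha i0; have := ha i1; have := ha i2; rewrite /cross /= => h2 h1 h0.
have [p ep] := kill_varE i0 (a i0).
have k0 : kill_var i0 (a i0) = 0.
  have := congr1 (kill_var i0) h2.
  rewrite kill_var0 kill_varB !kill_varM !kill_varX /= mul0r sub0r => /eqP.
  by rewrite oppr_eq0 mulf_eq0 (negPf (mpolyX_neq0 _)) /= => /eqP.
have e0 : a i0 = 'X_i0 * p by rewrite ep k0 addr0.
exists p; apply: ord3_ind; rewrite ?e0 1?mulrC //.
- apply: (mulfI (mpolyX_neq0 i0)); apply: (eq_lincomb1 1 h2); rewrite e0; ring.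
- apply: (mulfI (mpolyX_neq0 i0)); apply: (eq_lincomb1 (-1) h1); rewrite e0; ring.
Qed.

Lemma coordinates_dot : dot_exact (fun i => 'X_i : S).
Proof.
move=> a; rewrite /dot => ha.
have h : kill_var i0 (a i1) * 'X_i1 + kill_var i0 (a i2) * 'X_i2 = 0.
  have := congr1 (kill_var i0) ha.
  by rewrite kill_var0 !kill_varD !kill_varM !kill_varX /= mulr0 add0r.
have kk : kill_var i1 (kill_var i0 (a i2)) = 0.
  have := congr1 (kill_var i1) h.
  rewrite kill_var0 kill_varD !kill_varM !kill_varX /= mulr0 add0r => /eqP.
  by rewrite mulf_eq0 (negPf (mpolyX_neq0 _)) orbF => /eqP.
have [p ep] := kill_varE i0 (a i2).
have [q eq] := kill_varE i1 (kill_var i0 (a i2)).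
have [p' ep'] := kill_varE i0 (a i1).
have e2 : a i2 = 'X_i0 * p + 'X_i1 * q by rewrite ep eq kk addr0.
have e1 : a i1 = 'X_i0 * p' - q * 'X_i2.
  rewrite {1}ep'; congr (_ + _).
  apply: (mulfI (mpolyX_neq0 i1)); move: h; rewrite eq kk addr0 => h.
  by apply: (eq_lincomb1 1 h); ring.
exists (fun i => nth 0 [:: - q; p; - p'] i); apply: ord3_ind; rewrite /cross /=.
- apply: (mulfI (mpolyX_neq0 i0)); apply: (eq_lincomb1 1 ha); rewrite e1 e2; ring.
- by rewrite e1; ring.
- by rewrite e2; ring.
Qed.

End Coordinates.

(** * The gradient of a reduced polynomial *)

Section Gradient.
Variable K : numFieldType.
Local Notation S := {mpoly K[3]}.

Lemma euler_identity (n : nat) (f : S) : f \is n.-homog ->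
  \sum_(i < 3) 'X_i * f^`M(i) = n%:R * f.
Proof.
move=> hf.
have mono m : \sum_(i < 3) 'X_i * ('X_[m] : S)^`M(i) = (mdeg m)%:R * 'X_[m].
  rewrite mdegE natr_sum mulr_suml; apply: eq_bigr => i _.
  rewrite mderivX -scalerAr -mpolyXD; have [->|mi] := eqVneq (m i) 0%N.
    by rewrite scale0r mul0r.
  rewrite addmC submK; first by rewrite -mul_mpolyC mpolyC_nat.
  by apply/mnm_lepP => j; rewrite mnm1E; case: eqVneq => // <-; rewrite lt0n.
rewrite {1 2}[f]mpolyE.
under eq_bigr do rewrite linear_sum mulr_sumr.
rewrite exchange_big mulr_sumr /= !big_seq; apply: eq_bigr => m mf.
under eq_bigr do rewrite mderivZ -scalerAr.
by rewrite -scaler_sumr mono (dhomog_mf hf mf) scalerAr.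
Qed.

Lemma mderiv_homog (n : nat) (f : S) i : f \is n.+1.-homog -> f^`M(i) \is n.-homog.
Proof.
move=> hf; apply/dhomogP => m; rewrite mcoeff_msupp mcoeff_deriv => nz.
have : (m + U_(i))%MM \in msupp f.
  by rewrite mcoeff_msupp; apply: contraNneq nz => ->; rewrite mul0rn.
by move=> /(dhomog_mf hf) /=; rewrite mdegD mdeg1 addn1 => -[].
Qed.

Lemma mderiv_eq0_const (f : S) : (forall i, f^`M(i) = 0) -> f = (f@_0)%:MP.
Proof.
move=> f0; apply/mpolyP => m; rewrite mcoeffC; have [->|nz] := eqVneq m 0%MM.
  by rewrite mulr1.
have [i mi] : exists i, m i != 0%N.
  apply/existsP; apply: contraNT nz => /existsPn nz.
  by apply/eqP/mnmP => i; rewrite mnm0E; apply/eqP/negPn/nz.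
have := congr1 (mcoeff (m - U_(i))) (f0 i); rewrite mcoeff_deriv mcoeff0.
rewrite submK; last first.
  by apply/mnm_lepP => j; rewrite mnm1E; case: eqVneq => // <-; rewrite lt0n.
by move=> /eqP; rewrite mulrn_eq0 /= mulr0 => /eqP.
Qed.

Lemma msize_mderiv (f : S) i : (msize f^`M(i) <= (msize f).-1)%N.
Proof.
rewrite [X in (X <= _)%N]mmeasureE; apply/bigmax_leqP_seq => m.
rewrite mcoeff_msupp mcoeff_deriv => nz _.
have : (m + U_(i))%MM \in msupp f.
  by rewrite mcoeff_msupp; apply: contraNneq nz => ->; rewrite mul0rn.
by move/msize_mdeg_lt; rewrite mdegD mdeg1 addn1; case: (msize f).
Qed.

End Gradient.

Section ReducedGradient.
Variables (R : realType) (f : S3 R) (d : nat).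
Hypothesis d_gt0 : (0 < d)%N.
Hypothesis f_reduced : reduced_curve d f.
Local Notation grad := (fun i => f^`M(i)).

(** By Euler's identity such a prime divides [f], hence its square does. *)
Lemma no_prime_divides_gradient p :
  is_prime p -> (forall i, divides p (grad i)) -> False.
Proof.
case: f_reduced => nzf hf redf; case=> nzp nup pp dp.
have nzd : (d%:R : R[i]) != 0 by rewrite pnatr_eq0 -lt0n.
have [u fu] : divides p f.
  have -> : f = (d%:R^-1)%:MP * \sum_(i < 3) 'X_i * f^`M(i).
    by rewrite (euler_identity hf) -mpolyC_nat mulrA -mpolyCM mulVf // mul1r.
  apply: divides_mull; apply: (big_ind (divides p)).
  - by exists 0; rewrite mulr0.
  - exact: divides_add.
  by move=> i _; apply: divides_mull.
case: (pselect (divides p u)) => [[w uw]|ndu].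
  by move/negP: nup; apply; apply: (redf p w); rewrite fu uw; ring.
(* [p] divides its own partial derivatives, which have smaller degree *)
have dder i : p^`M(i) = 0.
  have : divides p (p^`M(i) * u).
    have [w ew] := dp i; exists (w - u^`M(i)).
    have := mderivM i p u; rewrite -fu ew => e.
    by apply: (eq_lincomb1 (-1) e); ring.
  case/pp => // -[w ew]; apply/eqP; apply: contraT => nzder.
  have nzw : w != 0 by apply: contraNneq nzder => w0; rewrite ew w0 mulr0.
  have := msize_mderiv p i; rewrite ew msizeM //.
  have : (0 < msize p)%N by rewrite lt0n msize_poly_eq0.
  have : (0 < msize w)%N by rewrite lt0n msize_poly_eq0.
  by move: (msize p) (msize w) => a b; lia.
have ep := mderiv_eq0_const dder.
move/negP: nup; apply; rewrite ep rmorph_unit // unitfE.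
by apply: contraNneq nzp => e; rewrite ep e mpolyC0.
Qed.

Lemma gradient_neq0 : exists k, grad k != 0.
Proof.
apply: contrapT => ng; case: f_reduced => nzf hf _.
have g0 i : f^`M(i) = 0 by apply/eqP; apply: contra_notT ng => ?; exists i.
have := euler_identity hf; rewrite big1 => [/esym/eqP|i _]; last by rewrite g0 mulr0.
by rewrite mulf_eq0 (negPf nzf) orbF -mpolyC_nat mpolyC_eq0 pnatr_eq0 -leqn0 leqNgt d_gt0.
Qed.

(** Cancel the prime factors of [q] one at a time: each divides the multiplier
    or all partial derivatives. *)
Lemma divides_gradient_multiple q p : q != 0 ->
  (forall i, divides q (p * grad i)) -> divides q p.
Proof.
move=> /(@factorial_mpoly _ 3)[u [s [uu]]].
elim: s q p => [|c s IHs] q p ps ->.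
  by move=> _; rewrite big_nil mulr1; exists (u^-1 * p); rewrite mulrA divrr ?mul1r.
have pc : is_prime c by apply: ps; rewrite mem_head.
rewrite big_cons => dp.
have [||p' ep] := IHs (u * \prod_(c <- s) c) p _ erefl.
- by move=> e es; apply: ps; rewrite inE es orbT.
- by move=> i; have [w ->] := dp i; exists (c * w); ring.
have nzq : u * \prod_(c <- s) c != 0.
  rewrite mulf_neq0 //; first by apply: contraTneq uu => ->; rewrite unitr0.
  rewrite prodf_seq_neq0; apply/allP => e es /=.
  by have [] := ps e; rewrite // inE es orbT.
have dc i : divides c (p' * grad i).
  have [w ew] := dp i; exists w; apply: (mulfI nzq).
  by apply: (eq_lincomb1 1 ew); rewrite ep; ring.
case: (pselect (divides c p')) => [[w ew]|ndc]; first by exists w; rewrite ep ew; ring.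
exfalso; apply: (no_prime_divides_gradient pc) => i.
by case: pc (dc i) => _ _ /[apply] -[].
Qed.

Lemma gradient_cross : cross_exact grad.
Proof.
move=> v cv.
have sym i j : grad i * v j = grad j * v i := cross_eq0_sym cv i j.
have [k nzk] := gradient_neq0.
have [|p ep] := divides_gradient_multiple (p := v k) nzk.
  by move=> i; exists (v i); rewrite sym mulrC.
by exists p => i; apply: (mulfI nzk); rewrite sym ep; ring.
Qed.

End ReducedGradient.

(** * The Jacobian module of a curve of type 2A *)

Section JacobianModule.
Variables (R : realType) (f : S3 R) (d d1 d2 d3 : nat).
Local Notation S := (S3 R).
Local Notation grad := (fun i => f^`M(i)).
Hypothesis d_ge3 : (3 <= d)%N.
Hypothesis f_reduced : reduced_curve d f.
Hypothesis d12 : (d1 <= d2)%N.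
Hypothesis d23 : (d2 <= d3)%N.
Hypothesis type2 : (d1 + d2 = d.+1)%N.
Variable r : 'I_3 -> 'I_3 -> S.
Hypothesis r_syz : forall i, dot (r i) grad = 0.
Hypothesis r_gen :
  forall v, dot v grad = 0 -> exists t, forall l, v l = lincomb t r l.

Definition syzygy_degree (i : 'I_3) : int := nth 0 [:: d1%:Z; d2%:Z; d3%:Z] i.
Hypothesis r_homog : forall i l, homogeneous (syzygy_degree i) (r i l).

(** The relation [g] between the three syzygies lives in degree [d3 + 2]; its
    coefficient at the third one is therefore a conic. *)
Definition relation_degree (i : 'I_3) : int := d3%:Z + 2 - syzygy_degree i.

(** The degree of the class that generates the Jacobian module. *)
Definition generator_degree : int := 2 * d%:Z - d3%:Z - 4.

Let grad_homog i : homogeneous (d%:Z - 1) (grad i).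
Proof.
have -> : d%:Z - 1 = d.-1 by lia.
apply/homogeneousE/mderiv_homog; rewrite prednK; last by lia.
by case: f_reduced.
Qed.

Let d_gt0 : (0 < d)%N. Proof. by lia. Qed.
Let grad_neq0 := gradient_neq0 d_gt0 f_reduced.
Let grad_cross := gradient_cross d_gt0 f_reduced.

Lemma homogeneous_cross (a b : 'I_3 -> S) (j k : int) l :
  (forall i, homogeneous j (a i)) -> (forall i, homogeneous k (b i)) ->
  homogeneous (j + k) (cross a b l).
Proof.
by move=> ha hb; move: l; apply: ord3_ind; rewrite /cross /=;
  apply: homogeneousB; apply: homogeneousM.
Qed.

(** The cross product of two syzygies is a multiple of the gradient. Its cofactor
    can be replaced by a homogeneous component because the gradient and the
    syzygies are homogeneous. *)
Lemma homogeneous_cofactor (a b : 'I_3 -> S) (j k m : int) :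
  dot a grad = 0 -> dot b grad = 0 ->
  (forall i, homogeneous j (a i)) -> (forall i, homogeneous k (b i)) ->
  m + d%:Z - 1 = j + k ->
  exists g, homogeneous m g /\ forall l, cross a b l = g * grad l.
Proof.
move=> a0 b0 ha hb em.
have [|p ep] := @grad_cross (cross a b).
  by move=> i; rewrite cross_cross a0 b0 !mulr0 subrr.
exists (component m p); split; first exact: homogeneous_component.
move=> l; rewrite -(homogeneous_cross l ha hb) ep [RHS]mulrC [p * _]mulrC.
by rewrite (componentM _ _ (grad_homog l)); congr (_ * component _ _); lia.
Qed.

Lemma graded_relation : exists g : 'I_3 -> S,
  [/\ forall i, homogeneous (relation_degree i) (g i),
      forall l, cross (r i1) (r i2) l = g i0 * grad l,
      forall l, cross (r i2) (r i0) l = g i1 * grad l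
    & forall l, cross (r i0) (r i1) l = g i2 * grad l].
Proof.
have h i j m : m + d%:Z - 1 = syzygy_degree i + syzygy_degree j ->
    exists g, homogeneous m g /\ forall l, cross (r i) (r j) l = g * grad l.
  by apply: homogeneous_cofactor.
have [|g0 [hg0 eg0]] := h i1 i2 (relation_degree i0).
  by rewrite /relation_degree /syzygy_degree /=; lia.
have [|g1 [hg1 eg1]] := h i2 i0 (relation_degree i1).
  by rewrite /relation_degree /syzygy_degree /=; lia.
have [|g2 [hg2 eg2]] := h i0 i1 (relation_degree i2).
  by rewrite /relation_degree /syzygy_degree /=; lia.
by exists (fun i => nth 0 [:: g0; g1; g2] i); split=> //; apply: ord3_ind.
Qed.

Section Relation.
Variable g : 'I_3 -> S.
Hypothesis g_homog : forall i, homogeneous (relation_degree i) (g i).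
Hypothesis g0E : forall l, cross (r i1) (r i2) l = g i0 * grad l.
Hypothesis g1E : forall l, cross (r i2) (r i0) l = g i1 * grad l.
Hypothesis g2E : forall l, cross (r i0) (r i1) l = g i2 * grad l.

Let g_exact : dot_exact g := g_dot grad_neq0 grad_cross r_syz r_gen g0E g1E g2E.

(** The comparison map can be chosen of degree zero: replace its entries by their
    components of the degrees that the two complexes prescribe. *)
Lemma graded_comparison : exists (phi : 'I_3 -> 'I_3 -> S) (u : S),
  [/\ homogeneous generator_degree u,
      forall l i, r i l = cross g (phi l) i
    & forall i, dot grad (phi^~ i) = u * g i].
Proof.
have [phi [u [ephi eu]]] := comparison_map grad_neq0 grad_cross r_syz r_gen g0E g1E g2E.
pose e (i : 'I_3) : int := nth 0 [:: d2%:Z - 2; d1%:Z - 2; d1%:Z + d2%:Z - d3%:Z - 2] i.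
exists (fun l i => component (e i) (phi l i)), (component generator_degree u).
split; first exact: homogeneous_component.
  move=> l i; rewrite -[LHS](r_homog i l) ephi; move: i.
  by apply: ord3_ind; rewrite /cross /= componentB !(componentM _ _ (g_homog _));
     congr (_ * component _ _ - _ * component _ _);
     rewrite /relation_degree /syzygy_degree /e /=; lia.
move=> i; rewrite mulrC.
have ej : generator_degree = (d%:Z - 1 + e i) - relation_degree i.
  by move: i; apply: ord3_ind; rewrite /generator_degree /relation_degree /syzygy_degree /e /=; lia.
rewrite ej -(componentM _ _ (g_homog i)) [g i * u]mulrC -eu.
rewrite (component_dot _ _ grad_homog); apply: eq_dotr => l.
by congr (component _ _); lia.
Qed.

Definition relation_ideal (v : S) : Prop := exists b, v = dot b g.

Lemma relation_hilbert :
  let p := relation_degree i1 in let q := relation_degree i0 in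
  let M := if p == q then 2 * p - 1 else 2 * p in
  exists H : int -> nat,
    [/\ forall k, quotient_dim (homogeneous k) relation_ideal (H k),
        forall k, (H k)%:Z <= M,
        (H (if p == q then p - 1 else p))%:Z = M
      & forall k, p + q <= k -> H k = 0%N].
Proof.
move=> p q M.
have p2 : 2 <= p by rewrite /p /relation_degree /syzygy_degree /=; lia.
have pq : p <= q by rewrite /p /q /relation_degree /syzygy_degree /=; lia.
have [HM HM' H0] := hilbert_function_bounds p2 pq.
have c_gt0 : forall i, 0 < relation_degree i.
  by apply: ord3_ind; rewrite /relation_degree /syzygy_degree /=; lia.
have e2 : relation_degree i2 = 2 by rewrite /relation_degree /syzygy_degree /=; lia.
have := complete_intersection_hilbert g_homog c_gt0 g_exact; rewrite e2 => dimH.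
by eexists; split; [exact: dimH|exact: HM|exact: HM'|exact: H0].
Qed.

Variables (phi : 'I_3 -> 'I_3 -> S) (u : S).
Hypothesis u_homog : homogeneous generator_degree u.
Hypothesis phiE : forall l i, r i l = cross g (phi l) i.
Hypothesis uE : forall i, dot grad (phi^~ i) = u * g i.

Lemma jacobian_idealE h : jacobian_ideal f h <-> exists v, h = dot grad v.
Proof.
have sumE (v : 'I_3 -> S) : \sum_(i < 3) v i * f^`M(i) = dot grad v.
  by rewrite sum_ord3 ![v _ * _]mulrC.
by split=> -[v ->]; exists v; rewrite sumE.
Qed.

Lemma relation_ideal_colon s : relation_ideal s <-> exists v, s * u = dot grad v.
Proof.
split=> [[b ->]|[v e]]; last first.
  exact: (colon_u grad_neq0 grad_cross r_gen g0E g1E g2E phiE uE e).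
by exists (fun l => dot (phi l) b); rewrite (dot_phi uE).
Qed.

(** A complete intersection of three forms contains all forms of large degree,
    as its Hilbert function vanishes there. *)
Lemma relation_ideal_large :
  exists k, forall m : 'X_{1..3}, mdeg m = k -> relation_ideal 'X_[m].
Proof.
have [H [dimH _ _ H0]] := relation_hilbert.
exists (absz (relation_degree i1 + relation_degree i0)) => m mk.
apply: (quotient_dim0 (P := homogeneous (mdeg m)) (Q := relation_ideal)).
  have e : H (mdeg m) = 0%N by apply: H0; lia.
  by have := dimH (mdeg m); rewrite e.
by apply/homogeneousE; rewrite dhomogX.
Qed.

(** A power of the irrelevant ideal lies in the ideal of [g], which multiplies
    [u] into the Jacobian ideal; conversely the ideal of the gradient and [u]
    is saturated. *)
Lemma saturated_idealE y :
  saturated_ideal f y <-> exists v s, y = dot grad v + s * u.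
Proof.
split=> [[k]|[v [s ->]]]; last first.
  have [k kI] := relation_ideal_large.
  exists k => m /kI/relation_ideal_colon[w ew]; apply/jacobian_idealE.
  exists (fun i => 'X_[m] * v i + s * w i).
  by rewrite dot_comb mulrDr -ew mulrCA.
elim: k y => [|k IHk] y Jy.
  have /jacobian_idealE[v] := Jy 0%MM mdeg0.
  by rewrite mpolyX0 mul1r => ->; exists v, 0; rewrite mul0r addr0.
have X_neq0 : exists k, ('X_k : S) != 0 by exists i0; apply: mpolyX_neq0.
apply: (cone_saturated grad_neq0 grad_cross r_syz r_gen g0E g1E g2E phiE uE X_neq0
  (@coordinates_cross _) (@coordinates_dot _)) => i.
apply: IHk => m mk; rewrite mulrA -mpolyXD; apply: Jy.
by rewrite mdegD mdeg1 mk addn1.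
Qed.

Lemma jacobian_ideal_submodule : submodule (jacobian_ideal f).
Proof.
split; first by apply/jacobian_idealE; exists (fun=> 0); rewrite dot0.
move=> a x y /jacobian_idealE[v ->] /jacobian_idealE[w ->]; apply/jacobian_idealE.
exists (fun i => a%:MP * v i + 1 * w i).
by rewrite dot_comb mul_mpolyC mul1r.
Qed.

Let saturation j (y : S) := y \is j.-homog /\ saturated_ideal f y.

Lemma saturation_submodule j : submodule (saturation j).
Proof.
split; first split; [exact: dhomog0| |].
  by apply/saturated_idealE; exists (fun=> 0), 0; rewrite dot0 mul0r addr0.
move=> a x y [hx /saturated_idealE[v [s ev]]] [hy /saturated_idealE[w [t ew]]].
split; first by rewrite rpredD // rpredZ.
apply/saturated_idealE; exists (fun i => a%:MP * v i + 1 * w i), (a%:MP * s + 1 * t).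
by rewrite ev ew dot_comb -mul_mpolyC; ring.
Qed.

Lemma jacobian_module_dimE j n :
  jacobian_module_dim f j n <-> quotient_dim (saturation j) (jacobian_ideal f) n.
Proof.
by split=> -[b [Pb bP]]; exists b; split=> //; [move=> y []|move=> y hy sy]; apply: bP.
Qed.

(** Multiplication by [u] identifies the shifted quotient by the ideal of [g]
    with the Jacobian module. *)
Lemma jacobian_module_hilbert (H : int -> nat) (j : nat) :
  (forall k, quotient_dim (homogeneous k) relation_ideal (H k)) ->
  jacobian_module_dim f j (H (j%:Z - generator_degree)).
Proof.
move=> dimH; apply/jacobian_module_dimE.
apply: (quotient_dim_iso (phi := u \*o idfun) jacobian_ideal_submodule
  (homogeneous_submodule (j%:Z - generator_degree)) _ _ _ _ (dimH _)).
- move=> s hs; split.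
    apply/homogeneousE; have := homogeneousM u_homog hs.
    by rewrite addrC subrK.
  by apply/saturated_idealE; exists (fun=> 0), s; rewrite dot0 add0r mulrC.
- by move=> s /relation_ideal_colon; rewrite /= mulrC => h; apply/jacobian_idealE.
- by move=> s _ /jacobian_idealE; rewrite /= mulrC => h; apply/relation_ideal_colon.
move=> y [/homogeneousE hy /saturated_idealE[v [s ey]]].
exists (component (j%:Z - generator_degree) s).
split; first exact: homogeneous_component.
apply/jacobian_idealE; exists (fun i => component (j%:Z - (d%:Z - 1)) (v i)).
rewrite -(component_dot _ _ grad_homog) -[y in LHS]hy ey /=.
by rewrite -(componentM _ _ u_homog) -componentB [s * u]mulrC addrK.
Qed.

Lemma jacobian_module_dim_uniq (j m n : nat) :
  jacobian_module_dim f j m -> jacobian_module_dim f j n -> m = n.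
Proof.
move=> /jacobian_module_dimE dm /jacobian_module_dimE dn.
exact: (quotient_dim_uniq (saturation_submodule j) jacobian_ideal_submodule dm dn).
Qed.

End Relation.
(** The maximum of the Hilbert function of [S / (g)] is attained in a degree
    that corresponds to a nonnegative degree [j0] of the Jacobian module. *)
Lemma freeness_defect_type2A :
  let p := d3%:Z + 2 - d2%:Z in
  (freeness_defect f)%:Z = if d1 == d2 then 2 * p - 1 else 2 * p.
Proof.
move=> p.
have [g [g_homog g0E g1E g2E]] := graded_relation.
have [H [dimH HM HM' _]] := relation_hilbert g_homog g0E g1E g2E.
have [phi [u [u_homog phiE uE]]] := graded_comparison g_homog g0E g1E g2E.
have dimN j := jacobian_module_hilbert g_homog g0E g1E g2E u_homog phiE uE j dimH.
have uniqN := jacobian_module_dim_uniq g_homog g0E g1E g2E phiE uE.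
move: HM HM'; rewrite /relation_degree /syzygy_degree /= -/p.
have -> : (p == d3%:Z + 2 - d1%:Z) = (d1 == d2) by rewrite /p; lia.
set M := if _ then _ else _; set k0 := if _ then _ else _ => HM HM'.
have [j0 ej0] : exists j0 : nat, j0%:Z - generator_degree = k0.
  exists (absz (k0 + generator_degree)).
  by rewrite /k0 /p /generator_degree; case: eqP; lia.
have defectM : is_freeness_defect f (H k0).
  split; first by exists j0; rewrite -ej0; apply: dimN.
  move=> j; exists (H (j%:Z - generator_degree)) => //.
  by have := HM (j%:Z - generator_degree); rewrite -HM'; lia.
rewrite -HM'; congr Posz; apply: xget_unique => // n [[j dimn] n_max].
have [k dimk lekn] := n_max j0.
have ek : k = H k0 by apply: uniqN dimk _; rewrite -ej0.
have en : n = H (j%:Z - generator_degree) by apply: uniqN dimn _.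
apply/eqP; rewrite eqn_leq -{2}ek lekn andbT en.
by have := HM (j%:Z - generator_degree); rewrite -HM'; lia.
Qed.

End JacobianModule.

Unset Implicit Arguments.

Theorem proposition1p13 (R : realType) (f : {mpoly R[i][3]})
    (d d1 d2 d3 : nat) (hd : (3 <= d)%N) (hf : reduced_curve d f)
    (hexp : exponents f [:: d1; d2; d3]) (htype : type2A d [:: d1; d2; d3]) :
  let nu : int := (freeness_defect f)%:Z in
  [/\ d1%:Z < d2%:Z - 2 -> nu = 2 * (d3%:Z - d2%:Z) + 4 /\ 4 <= nu,
      d1%:Z = d2%:Z - 2 -> nu = 2 * (d3%:Z - d1%:Z) /\ 4 <= nu,
      d1%:Z = d2%:Z - 1 -> nu = 2 * (d3%:Z - d1%:Z) + 2 /\ 4 <= nu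
    & d1%:Z = d2%:Z -> nu = 2 * (d3%:Z - d2%:Z) + 3 /\ 3 <= nu].
Proof.
have [h12 h23] : (d1 <= d2)%N /\ (d2 <= d3)%N.
  by case: hexp => /= /and3P[].
have hd12 : (d1 + d2 = d.+1)%N by case: htype; rewrite /curve_type /=; lia.
have [r [r_homog [r_gen _]]] : exists r : 'I_3 -> 'rV[S3 R]_3,
    (forall j : 'I_3, homog_triple (nth 0%N [:: d1; d2; d3] j) (r j)) /\
    minimal_generators_D0 f r by exact: hexp.2.
pose rv (i l : 'I_3) : S3 R := r i 0 l.
have D0E (s : 'rV[S3 R]_3) : D0 f s <-> dot (s 0) (fun i => f^`M(i)) = 0.
  by rewrite /D0 sum_ord3.
have rv_syz i : dot (rv i) (fun i => f^`M(i)) = 0.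
  apply/D0E/r_gen; exists (fun j => (j == i)%:R).
  rewrite (bigD1 i) ?inE //= eqxx scale1r big1 ?addr0 // => j /andP[_ /negPf ->].
  by rewrite scale0r.
have rv_gen v : dot v (fun i => f^`M(i)) = 0 ->
    exists t, forall l, v l = lincomb t rv l.
  move=> v0; have /D0E/r_gen[t et] : dot ((\row_l v l) 0) (fun i => f^`M(i)) = 0.
    by rewrite -v0 /dot !mxE.
  exists t => l; have := congr1 (fun w : 'rV_3 => w 0 l) et; rewrite mxE => ->.
  rewrite summxE; transitivity (\sum_(j < 3) t j * rv j l); last exact: sum_ord3.
  by apply: eq_big => j; rewrite ?inE // mxE.
have rv_homog i l : homogeneous (syzygy_degree d1 d2 d3 i) (rv i l).
  have -> : syzygy_degree d1 d2 d3 i = nth 0%N [:: d1; d2; d3] i.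
    by move: i; apply: ord3_ind.
  by apply/homogeneousE/r_homog.
move=> nu; have : nu = _ :=
  freeness_defect_type2A hd hf h12 h23 hd12 rv_syz rv_gen rv_homog.
by case: eqP => e ->; split; lia.
Qed.
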